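(* Let $0\le\alpha\le 1$ and $0\le\beta<1$, and let $f(z)=z+\sum_{n=2}^{\infty}a_nz^n$ belong to the class $\mathcal{M}^{\alpha}_{\sigma}(\beta)$. Then the following two bounds hold. (1) If $$0\le \beta\le 1-\frac{(1+\alpha)\left[3(1+3\alpha)+\sqrt{9(1+3\alpha)^2-48(1+\alpha)(1+3\alpha)+128(1+2\alpha)^2}\,\right]}{16(1+2\alpha)},$$ then $$|a_2a_4-a_3^2|\le \frac{4(1-\beta)^2}{3(1+\alpha)^3(1+3\alpha)}\left[4(1-\beta)^2+(1+\alpha)^2\right].$$ (2) If $$1-\frac{(1+\alpha)\left[3(1+3\alpha)+\sqrt{9(1+3\alpha)^2+128(1+2\alpha)^2}\,\right]}{32(1+2\alpha)}<\beta<1,$$ then $$|a_2a_4-a_3^2|\le \frac{(1-\beta)^2}{(1+\alpha)(1+3\alpha)}\cdot\frac{N}{D},$$ where $$N=(1-\beta)^2(1+3\alpha)(13+7\alpha)-12(1-\beta)(1+\alpha)(1+2\alpha)(1+3\alpha)-4(1+\alpha)^2(9\alpha^2+8\alpha+2)$$ and $$D=\left[16(1-\beta)^2(1+2\alpha)-6(1-\beta)(1+\alpha)(1+3\alpha)\right](1+2\alpha)+(1+\alpha)^2\left[3(1+\alpha)(1+3\alpha)-8(1+2\alpha)^2\right].$$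
   Context: Let $\mathbb{U}=\{z\in\mathbb{C}:|z|<1\}$, and let $\mathcal{A}$ be the class of functions $f(z)=z+\sum_{n=2}^{\infty}a_nz^n$ analytic in $\mathbb{U}$. Univalent means analytic and injective. Every $f\in\mathcal{A}$ univalent in $\mathbb{U}$ has an inverse $f^{-1}$ with $f^{-1}(f(z))=z$ for $z\in\mathbb{U}$ and $f(f^{-1}(w))=w$ for $|w|<r_0(f)$, where $r_0(f)\ge 1/4$; near $0$, $$f^{-1}(w)=w-a_2w^2+(2a_2^2-a_3)w^3-(5a_2^3-5a_2a_3+a_4)w^4+\cdots.$$ A function $f\in\mathcal{A}$ is bi-univalent in $\mathbb{U}$ if both $f$ and $f^{-1}$ are univalent in $\mathbb{U}$ (for $f^{-1}$ this means that the inverse defined near $0$ extends analytically to a univalent function on $\mathbb{U}$, still denoted $f^{-1}$). The class of bi-univalent functions is denoted $\sigma$. For $0\le\alpha\le1$ and $0\le\beta<1$, the class $\mathcal{M}^{\alpha}_{\sigma}(\beta)$ consists of all $f\in\sigma$ such that $$\Re\left((1-\alpha)\frac{zf'(z)}{f(z)}+\alpha\left(1+\frac{zf''(z)}{f'(z)}\right)\right)\ge\beta\qquad(z\in\mathbb{U})$$ and, with $g=f^{-1}$, $$\Re\left((1-\alpha)\frac{wg'(w)}{g(w)}+\alpha\left(1+\frac{wg''(w)}{g'(w)}\right)\right)\ge\beta\qquad(w\in\mathbb{U}).$$ The quotients $zf'(z)/f(z)$ and $wg'(w)/g(w)$ are understood to take the value $1$ at the origin (removable singularity). *)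

(* Defs.v *)
From Stdlib Require Import Reals.
From Coquelicot Require Import Coquelicot.

Local Open Scope R_scope.

(* Functions on the unit disk are represented by total functions [C -> C];
   their values outside the disk play no role. *)
Definition in_disk (z : C) : Prop := Cmod z < 1.

Definition analytic_at (f : C -> C) (z0 : C) : Prop :=
  exists (c : nat -> C) (r : R), 0 < r /\
    forall z : C, Cmod (z - z0)%C < r ->
      is_pseries (c : nat -> C_NormedModule) (z - z0)%C (f z).

Definition analytic_in_disk (f : C -> C) : Prop :=
  forall z : C, in_disk z -> analytic_at f z.

Definition univalent_in_disk (f : C -> C) : Prop :=
  analytic_in_disk f /\
  forall z1 z2 : C, in_disk z1 -> in_disk z2 -> f z1 = f z2 -> z1 = z2.

(* f(z) = z + sum_(n >= 2) a_n z^n on the unit disk. *)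
Definition normalized_expansion (f : C -> C) (a : nat -> C) : Prop :=
  a 0%nat = RtoC 0 /\ a 1%nat = RtoC 1 /\
  forall z : C, in_disk z -> is_pseries (a : nat -> C_NormedModule) z (f z).

Definition class_A (f : C -> C) : Prop :=
  analytic_in_disk f /\ exists a : nat -> C, normalized_expansion f a.

(* [g] is the univalent extension to the unit disk of the local inverse of [f]
   at 0.  For [f] in class A and univalent, the condition [in_disk (g w)] selects
   the branch with g 0 = 0, and g (f z) = z for z near 0 follows; g is then
   unique on the disk by analytic continuation. *)
Definition univalent_inverse (f g : C -> C) : Prop :=
  univalent_in_disk g /\
  exists r : R, 0 < r /\
    forall w : C, Cmod w < r -> in_disk (g w) /\ f (g w) = w.

Definition class_sigma (f : C -> C) : Prop :=
  class_A f /\ univalent_in_disk f /\ exists g : C -> C, univalent_inverse f g.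

(* z f'(z) / f(z), with the removable singularity at 0 filled in. *)
Definition log_derivative (f : C -> C) (z : C) : C :=
  if Ceq_dec z (RtoC 0) then RtoC 1 else (z * C_derive f z / f z)%C.

Definition alpha_convex_functional (alpha : R) (f : C -> C) (z : C) : C :=
  (RtoC (1 - alpha) * log_derivative f z +
   RtoC alpha * (RtoC 1 + z * C_derive (C_derive f) z / C_derive f z))%C.

Definition alpha_convex_of_order (alpha beta : R) (f : C -> C) : Prop :=
  forall z : C, in_disk z -> Re (alpha_convex_functional alpha f z) >= beta.

Definition class_M (alpha beta : R) (f : C -> C) : Prop :=
  class_sigma f /\ alpha_convex_of_order alpha beta f /\
  exists g : C -> C,
    univalent_inverse f g /\ alpha_convex_of_order alpha beta g.

(* Main.v *)
Require Import Defs.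
From Stdlib Require Import Reals Lra Lia Classical ClassicalEpsilon Wf_nat.
From Coquelicot Require Import Coquelicot.
Local Open Scope R_scope.

(** Let H_f be the functional of f whose real part is at least beta, and g the
    inverse of f.  The functions p = (H_f - beta)/(1 - beta) and
    q = (H_g - beta)/(1 - beta) have value 1 at 0 and nonnegative real part.
    Comparing Taylor coefficients ([alpha_convex_coefficient_region] for f and g,
    [inverse_coefficients] for the passage from f to g) gives q_1 = - p_1 and
    writes a_2 a_4 - a_3^2 as a polynomial in p_1, p_2 - q_2 and p_3 - q_3
    ([hankel_determinant_formula]).

    Positivity of Re p makes the Toeplitz matrices of its coefficients positive
    semidefinite ([toeplitz_form_ge0]), which is Caratheodory's description of the
    possible (p_1, p_2, p_3): a bound for |2 p_2 - p_1^2| and |p_3| in terms of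
    |p_1| and the modulus of one further parameter ([caratheodory_region]).  In
    the triangle inequality for a_2 a_4 - a_3^2 both further parameters may be
    replaced by 1 ([schur_moduli_extremal]), which leaves a quadratic polynomial
    in t = |p_1|^2 / 4 on [0, 1] ([hankel_determinant_majorant]).  Up to a
    positive factor its leading coefficient is the denominator D of the second
    bound.  The first condition on beta means D >= 0; the maximum is then at
    t = 1.  The second one forces D < 0, and the value at the vertex is the
    second bound.

    The complex analysis rests on two facts.  The coefficients of p see the
    values of Re p through a minimum principle for real parts
    ([Re_minimum_principle]) applied to an auxiliary function regular at 0; it
    needs only second order expansions at each point and the compactness of the
    disk.  And H_f has such expansions at every point of the disk, since f
    vanishes only at 0, while a zero of f' would create a pole of z f''/f'
    near which Re H_f is unbounded below
    ([alpha_convex_derivative_neq0]). *)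

(** * Termwise differentiation of complex power series *)

Lemma Cmod_norm_C (x : C) : Cmod x = norm (x : C_NormedModule).
Proof. reflexivity. Qed.

Lemma pow_n_Cpow (z : C) (n : nat) : pow_n (K := C_AbsRing) z n = (z ^ n)%C.
Proof. induction n as [|n IH]; [reflexivity|]. simpl. now rewrite IH. Qed.

Lemma is_pseries_Cpow (c : nat -> C) (h l : C) :
  is_pseries (c : nat -> C_NormedModule) h l <->
  is_series (fun n => (c n * h ^ n)%C : C_NormedModule) l.
Proof.
  assert (E : forall n, scal (pow_n (K := C_AbsRing) h n) (c n : C_NormedModule)
                        = (c n * h ^ n)%C).
  { intro n. rewrite pow_n_Cpow. apply Cmult_comm. }
  unfold is_pseries; split; apply is_series_ext; intro n; [|symmetry]; apply E.
Qed.

Lemma Cmod_is_series_le (a : nat -> C) (b : nat -> R) (l : C) (s : R) :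
  is_series (a : nat -> C_NormedModule) l -> (forall n, Cmod (a n) <= b n) ->
  is_series b s -> Cmod l <= s.
Proof.
  intros Ha Hab Hb.
  apply (@is_lim_seq_le (fun n => Cmod (sum_n (a : nat -> C_NormedModule) n))
           (sum_n b) (Cmod l) s).
  - intro n. unfold sum_n. rewrite Cmod_norm_C.
    eapply Rle_trans; [apply norm_sum_n_m|].
    apply sum_n_m_le. intro k. rewrite <- Cmod_norm_C. apply Hab.
  - rewrite Cmod_norm_C.
    apply (filterlim_comp _ _ _ (sum_n (a : nat -> C_NormedModule)) norm eventually
             (locally (l : C_NormedModule))); [exact Ha|].
    apply filterlim_norm.
  - exact Hb.
Qed.

Lemma pseries_coefficient_bound (c : nat -> C) (rho : R) (l : C) :
  0 < rho -> is_pseries (c : nat -> C_NormedModule) (RtoC rho) l ->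
  exists M, forall n, Cmod (c n) * rho ^ n <= M.
Proof.
  intros Hr Hs. apply is_pseries_Cpow in Hs.
  destruct (filterlim_bounded _ (ex_intro _ l Hs)) as [M HM].
  exists (2 * M). intro n.
  assert (E : Cmod (c n) * rho ^ n = Cmod (c n * RtoC rho ^ n)).
  { rewrite Cmod_mult, Cmod_pow, Cmod_R, (Rabs_pos_eq rho) by lra. reflexivity. }
  rewrite E. clear E.
  destruct n as [|n].
  - specialize (HM 0%nat). rewrite sum_O, <- Cmod_norm_C in HM.
    pose proof (Cmod_ge_0 (c 0%nat * RtoC rho ^ 0)%C). lra.
  - pose proof (HM n) as H1. pose proof (HM (S n)) as H2.
    rewrite sum_Sn, <- Cmod_norm_C in H2. rewrite <- Cmod_norm_C in H1.
    unfold plus in H2; simpl in H2.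
    set (s := sum_n (fun n : nat => (c n * RtoC rho ^ n)%C : C_NormedModule) n : C) in *.
    change (c (S n) * (RtoC rho * RtoC rho ^ n))%C
      with (c (S n) * RtoC rho ^ S n)%C in H2.
    set (t := (c (S n) * RtoC rho ^ S n)%C) in *.
    replace t with ((s + t) + - s)%C by ring.
    eapply Rle_trans; [apply Cmod_triangle|]. rewrite Cmod_opp.
    change (Cmod (s + t) <= M) in H2. lra.
Qed.

Lemma pow_succ_bernoulli (rho d : R) (n : nat) :
  0 <= rho -> 0 <= d -> INR n * rho ^ pred n * d <= (rho + d) ^ n.
Proof.
  intros Hr Hd. induction n as [|n IH]; [simpl; lra|].
  rewrite S_INR. simpl pred.
  assert (Hp : rho ^ n <= (rho + d) ^ n) by (apply pow_incr; lra).
  assert (H0 : 0 <= rho ^ n) by (apply pow_le; lra).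
  simpl ((rho + d) ^ S n).
  destruct n as [|n].
  - simpl. lra.
  - simpl pred in IH. change (rho ^ S n) with (rho * rho ^ n) in *.
    set (k := INR (S n)) in *. set (x := rho ^ n) in *. set (y := (rho + d) ^ S n) in *.
    nra.
Qed.

(** The remainder of the tangent of the n-th power is a sum of monomials of
    degree n in z and w with about n^2/2 terms; widening the radius from rho to
    rho + d absorbs that count, so that only geometric series are needed below. *)
Lemma pow_tangent_estimate (z w : C) (rho d : R) (n : nat) :
  Cmod z <= rho -> Cmod w <= rho -> 0 < d ->
  Cmod (w ^ n - z ^ n - INR n * z ^ pred n * (w - z)) * d ^ 2
    <= Cmod (w - z) ^ 2 * (rho + d) ^ n.
Proof.
  intros Hz Hw Hd.
  assert (Hr : 0 <= rho) by (pose proof (Cmod_ge_0 z); lra).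
  induction n as [|n IH].
  - replace (w ^ 0 - z ^ 0 - INR 0 * z ^ pred 0 * (w - z))%C with (RtoC 0)
      by (simpl; ring).
    rewrite Cmod_0. pose proof (pow2_ge_0 (Cmod (w - z))). simpl in *. lra.
  - set (E := (w ^ n - z ^ n - INR n * z ^ pred n * (w - z))%C) in *.
    assert (HE : (w ^ S n - z ^ S n - INR (S n) * z ^ pred (S n) * (w - z))%C
                 = (w * E + INR n * z ^ pred n * (w - z) ^ 2)%C).
    { unfold E. rewrite S_INR, RtoC_plus. simpl pred.
      destruct n as [|n]; [simpl; ring|]. simpl pred. rewrite !Cpow_S. ring. }
    rewrite HE.
    assert (H1 := Cmod_triangle (w * E) (INR n * z ^ pred n * (w - z) ^ 2)).
    rewrite !Cmod_mult, !Cmod_pow, Cmod_R, (Rabs_pos_eq (INR n)) in H1 by apply pos_INR.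
    assert (H2 := pow_succ_bernoulli rho d n Hr (Rlt_le _ _ Hd)).
    assert (H3 : Cmod z ^ pred n <= rho ^ pred n)
      by (apply pow_incr; split; [apply Cmod_ge_0|lra]).
    assert (H4 : INR n * Cmod z ^ pred n * d <= (rho + d) ^ n).
    { eapply Rle_trans; [|exact H2]. apply Rmult_le_compat_r; [lra|].
      apply Rmult_le_compat_l; [apply pos_INR|exact H3]. }
    pose proof (Cmod_ge_0 E). pose proof (Cmod_ge_0 w).
    pose proof (pow2_ge_0 (Cmod (w - z))) as H5.
    change ((rho + d) ^ S n) with ((rho + d) * (rho + d) ^ n).
    set (u := INR n * Cmod z ^ pred n) in *. set (y := (rho + d) ^ n) in *.
    set (v := Cmod (w - z) ^ 2) in *. set (e := Cmod E) in *. set (m := Cmod w) in *.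
    eapply Rle_trans.
    { apply Rmult_le_compat_r; [apply pow2_ge_0|exact H1]. }
    assert (H6 : m * (e * d ^ 2) <= rho * (v * y)).
    { apply Rmult_le_compat; try lra. apply Rmult_le_pos; [lra|apply pow2_ge_0]. }
    assert (H7 : v * d * (u * d) <= v * d * y).
    { apply Rmult_le_compat_l; [nra|lra]. }
    nra.
Qed.

Definition derived_coefficients (c : nat -> C) (n : nat) : C :=
  (INR (S n) * c (S n))%C.

Lemma geometric_majorant (M x : R) : 0 <= x < 1 ->
  is_series (fun n => M * x ^ n) (M * / (1 - x)).
Proof.
  intros Hx. apply (is_series_scal M (fun n => x ^ n)).
  apply is_series_geom. rewrite Rabs_pos_eq; lra.
Qed.

Lemma ex_series_dominated (a : nat -> C) (M x : R) : 0 <= x < 1 ->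
  (forall n, Cmod (a n) <= M * x ^ n) -> ex_series (a : nat -> C_NormedModule).
Proof.
  intros Hx H.
  apply (@ex_series_le C_AbsRing C_CompleteNormedModule a (fun n => M * x ^ n)).
  - intro n. exact (eq_ind _ (fun t => t <= _) (H n) _ (Cmod_norm_C (a n))).
  - eexists. now apply geometric_majorant.
Qed.

Lemma pseries_derivative (c : nat -> C) (r : R) (F : C -> C) :
  (forall h, Cmod h < r -> is_pseries (c : nat -> C_NormedModule) h (F h)) ->
  forall h, Cmod h < r ->
  exists D : C, is_pseries (derived_coefficients c : nat -> C_NormedModule) h D /\
    exists K d, 0 < d /\ forall w, Cmod (w - h) < d ->
      Cmod (F w - F h - (w - h) * D) <= K * Cmod (w - h) ^ 2.
Proof.
  intros HF h Hh.
  pose proof (Cmod_ge_0 h) as Hh0.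
  set (d := (r - Cmod h) / 4). assert (Hd : 0 < d) by (unfold d; lra).
  set (rho := Cmod h + d). set (R2 := rho + 2 * d).
  assert (HR2 : 0 < R2 /\ R2 < r) by (unfold R2, rho, d in *; lra).
  destruct (pseries_coefficient_bound c R2 (F (RtoC R2))) as [M HM]; [lra| |].
  { apply HF. rewrite Cmod_R, Rabs_pos_eq; lra. }
  set (x := (rho + d) / R2).
  assert (Hx : 0 <= x < 1).
  { unfold x; split.
    - apply Rmult_le_pos; [unfold rho; lra|]. left. apply Rinv_0_lt_compat; lra.
    - apply (Rmult_lt_reg_r R2); [lra|]. unfold Rdiv.
      rewrite Rmult_assoc, Rinv_l, Rmult_1_r, Rmult_1_l by lra. unfold R2. lra. }
  assert (Hmaj : forall n, Cmod (c n) * (rho + d) ^ n <= M * x ^ n).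
  { intro n. unfold x, Rdiv. rewrite Rpow_mult_distr, pow_inv.
    assert (0 < R2 ^ n) by (apply pow_lt; lra).
    assert (0 <= (rho + d) ^ n) by (apply pow_le; unfold rho; lra).
    replace (Cmod (c n) * (rho + d) ^ n)
      with (Cmod (c n) * R2 ^ n * ((rho + d) ^ n * / R2 ^ n)) by (field; lra).
    apply Rmult_le_compat_r; [|apply HM].
    apply Rmult_le_pos; [lra|]. left. now apply Rinv_0_lt_compat. }
  assert (Hex : ex_series (fun n => (derived_coefficients c n * h ^ n)%C : C_NormedModule)).
  { apply (ex_series_dominated _ (M * x / d) x Hx). intro n.
    unfold derived_coefficients. rewrite !Cmod_mult, Cmod_pow, Cmod_R.
    rewrite (Rabs_pos_eq (INR (S n))) by apply pos_INR.
    assert (H1 := pow_succ_bernoulli rho d (S n) ltac:(unfold rho; lra) ltac:(lra)).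
    simpl pred in H1.
    assert (H2 : Cmod h ^ n <= rho ^ n) by (apply pow_incr; unfold rho; lra).
    assert (H3 := Hmaj (S n)).
    apply (Rmult_le_reg_r d); [lra|].
    replace (M * x / d * x ^ n * d) with (M * x ^ S n) by (simpl; field; lra).
    eapply Rle_trans; [|exact H3].
    replace (INR (S n) * Cmod (c (S n)) * Cmod h ^ n * d)
      with (Cmod (c (S n)) * (INR (S n) * Cmod h ^ n * d)) by ring.
    apply Rmult_le_compat_l; [apply Cmod_ge_0|].
    eapply Rle_trans; [|exact H1]. apply Rmult_le_compat_r; [lra|].
    apply Rmult_le_compat_l; [apply pos_INR|lra]. }
  destruct Hex as [D HD].
  exists D. split; [now apply is_pseries_Cpow|].
  exists (M * / (1 - x) * / d ^ 2), d. split; [exact Hd|]. intros w Hw.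
  assert (Hw' : Cmod w <= rho).
  { replace w with (h + (w - h))%C by ring.
    eapply Rle_trans; [apply Cmod_triangle|]. unfold rho. lra. }
  (* Reindexed so that its n-th term pairs with w^n - h^n. *)
  assert (HDs : is_series (fun n => (INR n * c n * h ^ pred n)%C : C_NormedModule) D).
  { apply is_series_decr_1.
    replace (plus D _) with D; [exact HD|].
    assert (Hz : forall u v : C, (u = u + - (INR 0 * v * h ^ 0))%C)
      by (intros; simpl; ring).
    apply Hz. }
  assert (Hser : is_series
    (fun n => (c n * (w ^ n - h ^ n - INR n * h ^ pred n * (w - h)))%C : C_NormedModule)
    (F w - F h - (w - h) * D)%C).
  { assert (A := proj1 (is_pseries_Cpow _ _ _) (HF w ltac:(unfold R2, rho in *; lra))).
    assert (B := proj1 (is_pseries_Cpow _ _ _) (HF h Hh)).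
    assert (E := is_series_scal (w - h)%C _ _ HDs).
    assert (G := is_series_minus _ _ _ _ (is_series_minus _ _ _ _ A B) E).
    eapply is_series_ext; [|exact G].
    intro n. change (@eq C (c n * w ^ n + - (c n * h ^ n)
                     + - ((w - h) * (INR n * c n * h ^ pred n)))
                     (c n * (w ^ n - h ^ n - INR n * h ^ pred n * (w - h))))%C. ring. }
  eapply Rle_trans.
  { apply (Cmod_is_series_le _ (fun n => (Cmod (w - h) ^ 2 * / d ^ 2 * M) * x ^ n)
             _ _ Hser).
    2:{ apply geometric_majorant; exact Hx. }
    intro n. rewrite Cmod_mult.
    assert (H1 := pow_tangent_estimate h w rho d n ltac:(unfold rho; lra) Hw' Hd).
    assert (H2 := Hmaj n).
    assert (Hd2 : 0 < d ^ 2) by (apply pow_lt; lra).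
    apply (Rmult_le_reg_r (d ^ 2)); [lra|].
    replace (Cmod (w - h) ^ 2 * / d ^ 2 * M * x ^ n * d ^ 2)
      with (Cmod (w - h) ^ 2 * (M * x ^ n)) by (field; lra).
    eapply Rle_trans.
    2:{ apply Rmult_le_compat_l; [apply pow2_ge_0|exact H2]. }
    rewrite Rmult_assoc.
    eapply Rle_trans.
    { apply Rmult_le_compat_l; [apply Cmod_ge_0|exact H1]. }
    apply Req_le. ring. }
  apply Req_le. field. split; [lra|]. lra.
Qed.

Lemma C_derive_of_quadratic_remainder (f : C -> C) (z D : C) (K d : R) :
  0 < d ->
  (forall w, Cmod (w - z) < d -> Cmod (f w - f z - (w - z) * D) <= K * Cmod (w - z) ^ 2) ->
  C_derive f z = D.
Proof.
  intros Hd H. apply is_C_derive_unique. split; [apply is_linear_scal_l|].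
  intros x Hx.
  assert (x = z).
  { symmetry. apply (is_filter_lim_locally_unique (V := AbsRing_NormedModule C_AbsRing) z x). exact Hx. }
  subst x. intros eps.
  assert (HK : 0 < Rabs K + 1) by (pose proof (Rabs_pos K); lra).
  assert (Hm : 0 < Rmin d (eps / (Rabs K + 1))).
  { apply Rmin_pos; [lra|]. apply Rdiv_lt_0_compat; [apply cond_pos|lra]. }
  exists (mkposreal _ Hm). intros w Hw.
  change (Cmod (w - z) < Rmin d (eps / (Rabs K + 1))) in Hw.
  assert (H1 : Cmod (w - z) < d) by (eapply Rlt_le_trans; [exact Hw|apply Rmin_l]).
  assert (H2 : Cmod (w - z) < eps / (Rabs K + 1))
    by (eapply Rlt_le_trans; [exact Hw|apply Rmin_r]).
  change (Cmod (f w - f z - (w - z) * D) <= eps * Cmod (w - z)).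
  eapply Rle_trans; [now apply H|].
  pose proof (Cmod_ge_0 (w - z)). pose proof (Rle_abs K).
  assert (HKe : Cmod (w - z) * (Rabs K + 1) <= eps).
  { replace (pos eps) with (eps / (Rabs K + 1) * (Rabs K + 1)) by (field; lra).
    apply Rmult_le_compat_r; lra. }
  simpl. rewrite Rmult_1_r. nra.
Qed.

(** Stated for [C_derive] at every point of the disk of convergence, so that it
    can be iterated to reach f''. *)
Lemma is_pseries_C_derive (f : C -> C) (z0 : C) (c : nat -> C) (r : R) :
  (forall z, Cmod (z - z0) < r -> is_pseries (c : nat -> C_NormedModule) (z - z0)%C (f z)) ->
  forall z, Cmod (z - z0) < r ->
  is_pseries (derived_coefficients c : nat -> C_NormedModule) (z - z0)%C (C_derive f z).
Proof.
  intros Hf z Hz.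
  destruct (pseries_derivative c r (fun h => f (z0 + h)%C)) with (h := (z - z0)%C)
    as [D [HD [K [d [Hd HK]]]]].
  - intros h Hh. replace h with (z0 + h - z0)%C at 1 by ring. apply Hf.
    now replace (z0 + h - z0)%C with h by ring.
  - exact Hz.
  - replace (C_derive f z) with D; [exact HD|]. symmetry.
    apply (C_derive_of_quadratic_remainder f z D K d Hd). intros w Hw.
    specialize (HK (w - z0)%C).
    replace (w - z0 - (z - z0))%C with (w - z)%C in HK by ring.
    replace (z0 + (w - z0))%C with w in HK by ring.
    replace (z0 + (z - z0))%C with z in HK by ring. now apply HK.
Qed.

Lemma analytic_at_C_derive (f : C -> C) (z0 : C) :
  analytic_at f z0 -> analytic_at (C_derive f) z0.
Proof.
  intros [c [r [Hr H]]]. exists (derived_coefficients c), r. split; [exact Hr|].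
  now apply is_pseries_C_derive.
Qed.

(** * Finite expansions at a point *)

Definition near (z0 : C) (P : C -> Prop) : Prop :=
  exists d, 0 < d /\ forall z : C, Cmod (z - z0) < d -> P z.

Lemma near_and (z0 : C) (P Q : C -> Prop) :
  near z0 P -> near z0 Q -> near z0 (fun z => P z /\ Q z).
Proof.
  intros [d [Hd HP]] [e [He HQ]]. exists (Rmin d e).
  split; [now apply Rmin_pos|]. intros z Hz.
  pose proof (Rmin_l d e). pose proof (Rmin_r d e).
  split; [apply HP|apply HQ]; lra.
Qed.

Lemma near_imp (z0 : C) (P Q : C -> Prop) :
  (forall z, P z -> Q z) -> near z0 P -> near z0 Q.
Proof. intros H [d [Hd HP]]. exists d. split; [exact Hd|]. auto. Qed.

Lemma near_point (z0 : C) (P : C -> Prop) : near z0 P -> P z0.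
Proof.
  intros [d [Hd HP]]. apply HP. replace (z0 - z0)%C with (RtoC 0) by ring.
  now rewrite Cmod_0.
Qed.

Lemma near_ball (z0 c : C) (r : R) :
  Cmod (z0 - c) < r -> near z0 (fun z => Cmod (z - c) < r).
Proof.
  intros H. exists (r - Cmod (z0 - c)). split; [lra|]. intros z Hz.
  replace (z - c)%C with ((z - z0) + (z0 - c))%C by ring.
  pose proof (Cmod_triangle (z - z0) (z0 - c)). lra.
Qed.

Lemma near_in_disk (z0 : C) : in_disk z0 -> near z0 in_disk.
Proof.
  intros H. assert (E := near_ball z0 0 1).
  unfold Cminus in E. rewrite Copp_0, Cplus_0_r in E.
  apply (near_imp _ (fun z => Cmod (z + 0) < 1)); [|now apply E].
  intros z Hz. now rewrite Cplus_0_r in Hz.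
Qed.

Lemma near_neq (z0 c : C) : z0 <> c -> near z0 (fun z => z <> c).
Proof.
  intros H. exists (Cmod (z0 - c)). split.
  - apply Cmod_gt_0. intro E. apply H.
    replace z0 with ((z0 - c) + c)%C by ring. rewrite E. ring.
  - intros z Hz E. subst z.
    replace (c - z0)%C with (- (z0 - c))%C in Hz by ring.
    rewrite Cmod_opp in Hz. lra.
Qed.

(** [expands n g z0]: g has a polynomial expansion at z0 up to O((z - z0)^n).
    Peeling off one factor z - z0 at a time makes closure under products and
    inverses an induction on n with no convolution sums. *)
Fixpoint expands (n : nat) (g : C -> C) (z0 : C) : Prop :=
  match n with
  | O => exists M, near z0 (fun z => Cmod (g z) <= M)
  | S n => exists s, expands n s z0 /\
             near z0 (fun z => g z = g z0 + (z - z0) * s z)%C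
  end.

Lemma expands_ext (n : nat) (g k : C -> C) (z0 : C) :
  near z0 (fun z => g z = k z) -> expands n g z0 -> expands n k z0.
Proof.
  intros He. destruct n as [|n].
  - intros [M HM]. exists M. generalize (near_and _ _ _ He HM). apply near_imp.
    intros z [E H]. now rewrite <- E.
  - intros [s [Hs H]]. exists s. split; [exact Hs|].
    generalize (near_and _ _ _ He H). apply near_imp.
    intros z [E E']. now rewrite <- E, <- (near_point _ _ He).
Qed.

Lemma expands_bounded (n : nat) (g : C -> C) (z0 : C) :
  expands n g z0 -> exists M, near z0 (fun z => Cmod (g z) <= M).
Proof.
  revert g. induction n as [|n IH]; intro g; [trivial|].
  intros [s [Hs H]]. destruct (IH _ Hs) as [M HM].
  exists (Cmod (g z0) + Rabs M).
  assert (H1 : near z0 (fun z => Cmod (z - z0) < 1)).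
  { apply near_ball. replace (z0 - z0)%C with (RtoC 0) by ring. rewrite Cmod_0. lra. }
  generalize (near_and _ _ _ H1 (near_and _ _ _ H HM)). apply near_imp.
  intros z [A [E B]]. rewrite E.
  eapply Rle_trans; [apply Cmod_triangle|]. rewrite Cmod_mult.
  pose proof (Cmod_ge_0 (z - z0)). pose proof (Cmod_ge_0 (s z)).
  pose proof (Rle_abs M). nra.
Qed.

Lemma expands_pred (n : nat) (g : C -> C) (z0 : C) :
  expands (S n) g z0 -> expands n g z0.
Proof.
  revert g. induction n as [|n IH]; intros g H; [now apply (expands_bounded 1)|].
  destruct H as [s [Hs H]]. exists s. split; [now apply IH|exact H].
Qed.

Lemma expands_le (m n : nat) (g : C -> C) (z0 : C) :
  (m <= n)%nat -> expands n g z0 -> expands m g z0.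
Proof. induction 1; [trivial|]. intro H'. now apply IHle, expands_pred. Qed.

Lemma expands_const (n : nat) (c z0 : C) : expands n (fun _ => c) z0.
Proof.
  revert c. induction n as [|n IH]; intro c.
  - exists (Cmod c). exists 1. split; [lra|]. intros; lra.
  - exists (fun _ => RtoC 0). split; [apply IH|]. exists 1. split; [lra|].
    intros; ring.
Qed.

Lemma expands_id (n : nat) (z0 : C) : expands n (fun z => z) z0.
Proof.
  apply (expands_le n (S n)); [lia|].
  exists (fun _ => RtoC 1). split; [apply expands_const|]. exists 1. split; [lra|].
  intros; ring.
Qed.

Lemma expands_plus (n : nat) (g k : C -> C) (z0 : C) :
  expands n g z0 -> expands n k z0 -> expands n (fun z => g z + k z)%C z0.
Proof.
  revert g k. induction n as [|n IH]; intros g k.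
  - intros [M HM] [N HN]. exists (M + N). generalize (near_and _ _ _ HM HN).
    apply near_imp. intros z [A B].
    eapply Rle_trans; [apply Cmod_triangle|]. lra.
  - intros [s [Hs E]] [t [Ht F]]. exists (fun z => s z + t z)%C.
    split; [now apply IH|]. generalize (near_and _ _ _ E F). apply near_imp.
    intros z [A B]. rewrite A, B. ring.
Qed.

Lemma expands_mult (n : nat) (g k : C -> C) (z0 : C) :
  expands n g z0 -> expands n k z0 -> expands n (fun z => g z * k z)%C z0.
Proof.
  revert g k. induction n as [|n IH]; intros g k.
  - intros [M HM] [N HN]. exists (M * N). generalize (near_and _ _ _ HM HN).
    apply near_imp. intros z [A B]. rewrite Cmod_mult.
    apply Rmult_le_compat; try apply Cmod_ge_0; assumption.
  - intros Hg Hk. pose proof (expands_pred _ _ _ Hk) as Hk'.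
    destruct Hg as [s [Hs E]], Hk as [t [Ht F]].
    exists (fun z => g z0 * t z + s z * k z)%C. split.
    + apply expands_plus; apply IH; trivial. apply expands_const.
    + generalize (near_and _ _ _ E F). apply near_imp.
      intros z [A B]. rewrite A. rewrite B at 1 2. ring.
Qed.

Lemma expands_opp (n : nat) (g : C -> C) (z0 : C) :
  expands n g z0 -> expands n (fun z => - g z)%C z0.
Proof.
  intro H. apply (expands_ext n (fun z => RtoC (-1) * g z)%C).
  - exists 1. split; [lra|]. intros; ring.
  - apply expands_mult; [apply expands_const|exact H].
Qed.

Lemma expands_minus (n : nat) (g k : C -> C) (z0 : C) :
  expands n g z0 -> expands n k z0 -> expands n (fun z => g z - k z)%C z0.
Proof. intros. apply expands_plus; [|apply expands_opp]; assumption. Qed.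

Lemma expands_pow (n m : nat) (g : C -> C) (z0 : C) :
  expands n g z0 -> expands n (fun z => g z ^ m)%C z0.
Proof.
  intro H. induction m as [|m IH]; [exact (expands_const n 1 z0)|].
  exact (expands_mult n g (fun z => g z ^ m)%C z0 H IH).
Qed.

Lemma expands_near_nonzero (g : C -> C) (z0 : C) :
  expands 1 g z0 -> g z0 <> 0%R ->
  near z0 (fun z => Cmod (g z0) / 2 <= Cmod (g z)).
Proof.
  intros [s [[M HM] E]] H0. apply Cmod_gt_0 in H0.
  assert (HM1 : 0 < Rabs M + 1) by (pose proof (Rabs_pos M); lra).
  assert (Hb : near z0 (fun z => Cmod (z - z0) < Cmod (g z0) / 2 / (Rabs M + 1))).
  { apply near_ball. replace (z0 - z0)%C with (RtoC 0) by ring. rewrite Cmod_0.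
    apply Rdiv_lt_0_compat; lra. }
  generalize (near_and _ _ _ Hb (near_and _ _ _ HM E)). apply near_imp.
  intros z [A [B D]].
  assert (H1 : Cmod (z - z0) * (Rabs M + 1) <= Cmod (g z0) / 2).
  { replace (Cmod (g z0) / 2) with (Cmod (g z0) / 2 / (Rabs M + 1) * (Rabs M + 1))
      by (field; lra). apply Rmult_le_compat_r; lra. }
  assert (H2 : g z0 = (g z + - ((z - z0) * s z))%C) by (rewrite D; ring).
  assert (H3 := Cmod_triangle (g z) (- ((z - z0) * s z))).
  rewrite <- H2, Cmod_opp, Cmod_mult in H3.
  pose proof (Cmod_ge_0 (z - z0)). pose proof (Cmod_ge_0 (s z)). pose proof (Rle_abs M).
  nra.
Qed.

Lemma expands_near_neq0 (g : C -> C) (z0 : C) :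
  expands 1 g z0 -> g z0 <> 0%R -> near z0 (fun z => g z <> 0%R).
Proof.
  intros H H0. generalize (expands_near_nonzero g z0 H H0). apply near_imp.
  intros z Hz E. rewrite E, Cmod_0 in Hz. apply Cmod_gt_0 in H0. lra.
Qed.

Lemma expands_inv (n : nat) (g : C -> C) (z0 : C) :
  expands (S n) g z0 -> g z0 <> 0%R -> expands (S n) (fun z => / g z)%C z0.
Proof.
  intros Hg H0. pose proof (expands_le 1 (S n) _ _ ltac:(lia) Hg) as H1.
  generalize (expands_near_neq0 g z0 H1 H0). intro Hnz.
  revert Hg. generalize (S n). clear n. intros n.
  induction n as [|n IH]; intro Hg.
  - exists (/ (Cmod (g z0) / 2)).
    generalize (near_and _ _ _ Hnz (expands_near_nonzero g z0 H1 H0)). apply near_imp.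
    intros z [A B]. rewrite Cmod_inv by exact A.
    apply Cmod_gt_0 in H0. apply Rinv_le_contravar; lra.
  - pose proof (IH (expands_pred _ _ _ Hg)) as Hi.
    destruct Hg as [s [Hs E]].
    exists (fun z => - / g z0 * s z * / g z)%C. split.
    + apply expands_mult; [|exact Hi]. apply expands_mult; [apply expands_const|exact Hs].
    + generalize (near_and _ _ _ Hnz E). apply near_imp. intros z [A B].
      transitivity (/ g z0 + - / g z0 * / g z * ((g z0 + (z - z0) * s z) - g z0))%C;
        [|ring].
      rewrite <- B. field. now split.
Qed.

Lemma expands_div (n : nat) (g k : C -> C) (z0 : C) :
  expands (S n) g z0 -> expands (S n) k z0 -> k z0 <> 0%R ->
  expands (S n) (fun z => g z / k z)%C z0.
Proof. intros. apply (expands_mult (S n)); [|apply expands_inv]; assumption. Qed.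

Lemma expands_scale (n : nat) (g : C -> C) (r z0 : C) :
  expands n g (r * z0)%C -> expands n (fun z => g (r * z))%C z0.
Proof.
  assert (Hn : forall P, near (r * z0)%C P -> near z0 (fun z => P (r * z)%C)).
  { intros P [d [Hd H]]. exists (d / (Cmod r + 1)).
    pose proof (Cmod_ge_0 r).
    split; [apply Rdiv_lt_0_compat; lra|]. intros z Hz. apply H.
    replace (r * z - r * z0)%C with (r * (z - z0))%C by ring. rewrite Cmod_mult.
    assert (Cmod (z - z0) * (Cmod r + 1) < d).
    { replace d with (d / (Cmod r + 1) * (Cmod r + 1)) by (field; lra).
      apply Rmult_lt_compat_r; lra. }
    pose proof (Cmod_ge_0 (z - z0)). nra. }
  revert g. induction n as [|n IH]; intro g.
  - intros [M HM]. exists M. exact (Hn _ HM).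
  - intros [s [Hs E]]. exists (fun z => r * s (r * z))%C. split.
    + apply expands_mult; [apply expands_const|now apply IH].
    + generalize (Hn _ E). apply near_imp. intros z ->. ring.
Qed.

(** The step that makes power series satisfy the recursion defining [expands]. *)
Lemma pseries_shift (c : nat -> C) (r : R) (F : C -> C) : 0 < r ->
  (forall h, Cmod h < r -> is_pseries (c : nat -> C_NormedModule) h (F h)) ->
  F 0%R = c 0%nat /\ exists G : C -> C,
    (forall h, Cmod h < r ->
       is_pseries ((fun n => c (S n)) : nat -> C_NormedModule) h (G h)) /\
    (forall h, Cmod h < r -> F h = (c 0%nat + h * G h)%C).
Proof.
  intros Hr H.
  assert (F0 : forall (b : nat -> C) (l : C), is_pseries (b : nat -> C_NormedModule) (RtoC 0) l <-> l = b 0%nat).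
  { intros b l.
    assert (A := is_pseries_0 (V := C_NormedModule) b).
    split.
    - intro B. exact (filterlim_locally_unique (V := C_NormedModule) _ _ _ B A).
    - intros ->. exact A. }
  assert (E0 : F 0%R = c 0%nat).
  { apply F0. apply H. now rewrite Cmod_0. }
  split; [exact E0|].
  exists (fun h => if Ceq_dec h 0 then c 1%nat else ((F h - c 0%nat) / h)%C).
  split; intros h Hh; destruct (Ceq_dec h 0) as [->|N].
  - now apply F0.
  - assert (A := is_pseries_decr_1 (V := C_NormedModule) c h (/ h)%C (F h)).
    replace ((F h - c 0%nat) / h)%C with (/ h * (F h + - c 0%nat))%C by (field; exact N).
    apply A; [|now apply H]. apply Cinv_l, N.
  - rewrite E0. ring.
  - field. exact N.
Qed.

Lemma pseries_expands (n : nat) (c : nat -> C) (r : R) (F : C -> C) (z0 : C) : 0 < r ->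
  (forall z, Cmod (z - z0) < r -> is_pseries (c : nat -> C_NormedModule) (z - z0)%C (F z)) ->
  expands n F z0.
Proof.
  intros Hr. revert c F. induction n as [|n IH]; intros c F H.
  - destruct (pseries_coefficient_bound c (r / 2) (F (z0 + RtoC (r / 2))%C)) as [M HM].
    + lra.
    + replace (RtoC (r / 2)) with ((z0 + RtoC (r / 2)) - z0)%C at 1 by ring. apply H.
      replace (z0 + RtoC (r / 2) - z0)%C with (RtoC (r / 2)) by ring.
      rewrite Cmod_R, Rabs_pos_eq; lra.
    + exists (M * / (1 - / 2)). exists (r / 4). split; [lra|]. intros z Hz.
      assert (A := proj1 (is_pseries_Cpow _ _ _) (H z ltac:(lra))).
      apply (Cmod_is_series_le _ (fun n => M * (/ 2) ^ n) _ _ A);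
        [|apply geometric_majorant; lra].
      intro k. rewrite Cmod_mult, Cmod_pow.
      assert (B : Cmod (z - z0) ^ k <= (r / 2) ^ k * (/ 2) ^ k).
      { rewrite <- Rpow_mult_distr. apply pow_incr. split; [apply Cmod_ge_0|lra]. }
      assert (D : 0 <= (/ 2) ^ k) by (apply pow_le; lra).
      specialize (HM k). pose proof (Cmod_ge_0 (c k)).
      apply Rle_trans with (Cmod (c k) * ((r / 2) ^ k * (/ 2) ^ k));
        [now apply Rmult_le_compat_l|].
      rewrite <- Rmult_assoc. now apply Rmult_le_compat_r.
  - destruct (pseries_shift c r (fun h => F (z0 + h)%C) Hr) as [E [G [HG HF]]].
    + intros h Hh. replace h with (z0 + h - z0)%C at 1 by ring. apply H.
      now replace (z0 + h - z0)%C with h by ring.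
    + exists (fun z => G (z - z0)%C). split.
      * apply (IH (fun n => c (S n))). intros z Hz. now apply HG.
      * exists r. split; [exact Hr|]. intros z Hz.
        replace (F z0) with (c 0%nat) by (rewrite <- E; now rewrite Cplus_0_r).
        rewrite <- HF by exact Hz. f_equal. ring.
Qed.

Lemma analytic_expands (n : nat) (f : C -> C) (z0 : C) :
  analytic_at f z0 -> expands n f z0.
Proof. intros [c [r [Hr H]]]. exact (pseries_expands n c r f z0 Hr H). Qed.

Opaque expands.

(** * The minimum principle for real parts *)

Lemma Cmod_le_Re_Im (z : C) : Cmod z <= Rabs (Re z) + Rabs (Im z).
Proof.
  replace z with (RtoC (Re z) + Ci * RtoC (Im z))%C at 1.
  - eapply Rle_trans; [apply Cmod_triangle|].
    rewrite Cmod_mult, Cmod_Ci, !Cmod_R. lra.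
  - destruct z as [x y]. unfold Ci, RtoC, Cplus, Cmult; simpl. f_equal; ring.
Qed.

Lemma Im_le_Cmod (z : C) : Rabs (Im z) <= Cmod z.
Proof. eapply Rle_trans; [apply Rmax_r|apply Rmax_Cmod]. Qed.

(** Compactness for properties that weaken as their real parameter decreases:
    boundedness below and the attainment of an infimum both have this form. *)
Lemma closed_disk_gauge (Q : R -> C -> Prop) :
  (forall d e z, 0 < d <= e -> Q e z -> Q d z) ->
  (forall z, exists d, 0 < d /\ forall w, Cmod (w - z) < d -> Q d w) ->
  exists d, 0 < d /\ forall w, Cmod w <= 1 -> Q d w.
Proof.
  intros Hmono Hloc.
  assert (G : forall u v : R, exists d : posreal, forall w : C,
             Cmod (w - ((u, v) : C)) < 2 * d -> Q d w).
  { intros u v. destruct (Hloc (u, v)) as [d [Hd H]].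
    assert (Hd2 : 0 < d / 2) by lra.
    exists (mkposreal _ Hd2). simpl. intros w Hw. apply (Hmono _ d); [lra|].
    apply H. lra. }
  pose (delta := fun u v => proj1_sig (constructive_indefinite_description _ (G u v))).
  assert (Hdelta : forall u v (w : C), Cmod (w - ((u, v) : C)) < 2 * delta u v ->
                     Q (delta u v) w).
  { intros u v. unfold delta.
    now destruct (constructive_indefinite_description _ (G u v)) as [d H]. }
  destruct (compactness_value_2d (-1) 1 (-1) 1 delta) as [d Hd].
  exists d. split; [apply cond_pos|]. intros w Hw.
  assert (Hre := re_le_Cmod w). assert (Him := Im_le_Cmod w).
  apply NNPP. intro N.
  apply (Hd (Re w) (Im w)).
  - apply Rabs_le_between. lra.
  - apply Rabs_le_between. lra.
  - intros [u [v [_ [_ [H1 [H2 H3]]]]]]. apply N.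
    apply (Hmono _ (delta u v)); [split; [apply cond_pos|exact H3]|].
    apply Hdelta. eapply Rle_lt_trans; [apply Cmod_le_Re_Im|].
    destruct w as [x y]; simpl in *. unfold Rminus in *. lra.
Qed.

Lemma closed_disk_minimum (v : C -> R) :
  (forall z, Cmod z <= 1 -> forall eps, 0 < eps ->
     near z (fun w => Rabs (v w - v z) < eps)) ->
  exists z0, Cmod z0 <= 1 /\ forall z, Cmod z <= 1 -> v z0 <= v z.
Proof.
  intros Hc.
  assert (Hout : forall z, ~ Cmod z <= 1 -> near z (fun w => ~ Cmod w <= 1)).
  { intros z Hz. exists (Cmod z - 1). split; [lra|]. intros w Hw.
    assert (H := Cmod_triangle w (z - w)). replace (w + (z - w))%C with z in H by ring.
    replace (z - w)%C with (- (w - z))%C in H by ring. rewrite Cmod_opp in H. lra. }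
  (* The lower bound - / d lets one number serve as radius and as bound. *)
  destruct (closed_disk_gauge (fun d w => Cmod w <= 1 -> - / d <= v w)) as [b [Hb Hbv]].
  { intros d e z Hde H Hz. specialize (H Hz).
    assert (/ e <= / d) by (apply Rinv_le_contravar; lra). lra. }
  { intros z. destruct (classic (Cmod z <= 1)) as [Hz|Hz].
    - destruct (Hc z Hz 1 Rlt_0_1) as [d [Hd H]].
      pose proof (Rabs_pos (v z)) as Hp.
      exists (Rmin d (/ (Rabs (v z) + 1))).
      assert (H0 : 0 < / (Rabs (v z) + 1)) by (apply Rinv_0_lt_compat; lra).
      split; [now apply Rmin_pos|]. intros w Hw _.
      pose proof (Rmin_l d (/ (Rabs (v z) + 1))).
      assert (Hm := Rmin_r d (/ (Rabs (v z) + 1))).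
      apply Rinv_le_contravar in Hm; [|now apply Rmin_pos].
      rewrite Rinv_inv in Hm.
      assert (Hvw := H w ltac:(lra)). apply Rabs_def2 in Hvw.
      pose proof (Rabs_maj2 (v z)). lra.
    - destruct (Hout z Hz) as [d [Hd H]]. exists d. split; [exact Hd|].
      intros w Hw Hw'. now apply H in Hw. }
  destruct (completeness (fun y => exists z, Cmod z <= 1 /\ y = - v z)) as [m [Hub Hlub]].
  { exists (/ b). intros y [z [Hz ->]]. specialize (Hbv z Hz). lra. }
  { exists (- v 0%R), 0%R. rewrite Cmod_0. split; [lra|reflexivity]. }
  assert (Hinf : forall z, Cmod z <= 1 -> - m <= v z).
  { intros z Hz. assert (- v z <= m) by (apply Hub; now exists z). lra. }
  apply NNPP. intro N.
  assert (Hgt : forall z, Cmod z <= 1 -> - m < v z).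
  { intros z Hz. destruct (Hinf z Hz) as [H|H]; [exact H|].
    exfalso. apply N. exists z. split; [exact Hz|]. intros w Hw. rewrite <- H. auto. }
  (* An infimum that is not attained is missed locally, hence uniformly, by
     some d. *)
  destruct (closed_disk_gauge (fun d w => Cmod w <= 1 -> d - m <= v w)) as [d [Hd H]].
  { intros d e z Hde H Hz. specialize (H Hz). lra. }
  { intros z. destruct (classic (Cmod z <= 1)) as [Hz|Hz].
    - specialize (Hgt z Hz).
      destruct (Hc z Hz ((v z + m) / 2)) as [d [Hd H]]; [lra|].
      exists (Rmin d ((v z + m) / 2)). split; [apply Rmin_pos; lra|]. intros w Hw _.
      pose proof (Rmin_l d ((v z + m) / 2)). pose proof (Rmin_r d ((v z + m) / 2)).
      assert (Hvw := H w ltac:(lra)). apply Rabs_def2 in Hvw. lra.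
    - destruct (Hout z Hz) as [d [Hd H]]. exists d. split; [exact Hd|].
      intros w Hw Hw'. now apply H in Hw. }
  assert (m <= m - d); [|lra].
  apply Hlub. intros y [z [Hz ->]]. specialize (H z Hz). lra.
Qed.

Lemma expands_continuous (g : C -> C) (z0 : C) : expands 1 g z0 ->
  forall eps, 0 < eps -> near z0 (fun z => Cmod (g z - g z0) < eps).
Proof.
  intros [s [[M HM] E]] eps Heps.
  assert (HM1 : 0 < Rabs M + 1) by (pose proof (Rabs_pos M); lra).
  assert (Hb : near z0 (fun z => Cmod (z - z0) < eps / (Rabs M + 1))).
  { apply near_ball. replace (z0 - z0)%C with (RtoC 0) by ring. rewrite Cmod_0.
    apply Rdiv_lt_0_compat; lra. }
  generalize (near_and _ _ _ Hb (near_and _ _ _ HM E)). apply near_imp.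
  intros z [A [B D]].
  rewrite D. replace (g z0 + (z - z0) * s z - g z0)%C with ((z - z0) * s z)%C by ring.
  rewrite Cmod_mult.
  assert (H1 : Cmod (z - z0) * (Rabs M + 1) < eps).
  { replace eps with (eps / (Rabs M + 1) * (Rabs M + 1))
      by (field; lra). apply Rmult_lt_compat_r; lra. }
  pose proof (Cmod_ge_0 (z - z0)). pose proof (Cmod_ge_0 (s z)). pose proof (Rle_abs M).
  nra.
Qed.

(** Averaging over z0 + t i^k, k = 0..3, kills the first and second order terms
    of a complex expansion: a second-order shadow of the mean value property. *)
Lemma four_point_average (g : C -> C) (z0 : C) : expands 3 g z0 ->
  exists K d, 0 < d /\ forall t : R, 0 < t < d ->
    Cmod (g (z0 + t) + g (z0 - t) + g (z0 + Ci * t) + g (z0 - Ci * t) - 4 * g z0)%C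
    <= K * t ^ 3.
Proof.
  intros [s1 [[s2 [[s3 [[M [d3 [Hd3 HM]]] [d2 [Hd2 E2]]]] [d1 [Hd1 E1]]]] [d0 [Hd0 E0]]]].
  exists (4 * M). exists (Rmin (Rmin d0 d1) (Rmin d2 d3)).
  split; [repeat apply Rmin_pos; assumption|]. intros t Ht.
  assert (Hm : t < d0 /\ t < d1 /\ t < d2 /\ t < d3).
  { pose proof (Rmin_l (Rmin d0 d1) (Rmin d2 d3)). pose proof (Rmin_r (Rmin d0 d1) (Rmin d2 d3)).
    pose proof (Rmin_l d0 d1). pose proof (Rmin_r d0 d1).
    pose proof (Rmin_l d2 d3). pose proof (Rmin_r d2 d3). lra. }
  assert (HT : forall h : C, Cmod h = t ->
    g (z0 + h)%C = (g z0 + h * s1 z0 + h ^ 2 * s2 z0 + h ^ 3 * s3 (z0 + h))%C /\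
    Cmod (s3 (z0 + h)%C) <= M).
  { intros h Hh.
    assert (A : Cmod (z0 + h - z0) = t) by (rewrite <- Hh; f_equal; ring).
    split; [|apply HM; lra].
    rewrite (E0 (z0 + h)%C), (E1 (z0 + h)%C), (E2 (z0 + h)%C) by lra. simpl. ring. }
  assert (A1 : Cmod (RtoC t) = t) by (rewrite Cmod_R, Rabs_pos_eq; lra).
  assert (A2 : Cmod (- RtoC t)%C = t) by (now rewrite Cmod_opp).
  assert (A3 : Cmod (Ci * RtoC t)%C = t) by (rewrite Cmod_mult, Cmod_Ci; lra).
  assert (A4 : Cmod (- (Ci * RtoC t))%C = t) by (now rewrite Cmod_opp).
  destruct (HT _ A1) as [B1 D1], (HT _ A2) as [B2 D2], (HT _ A3) as [B3 D3],
    (HT _ A4) as [B4 D4].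
  change (z0 - t)%C with (z0 + - t)%C. change (z0 - Ci * t)%C with (z0 + - (Ci * t))%C.
  rewrite B1, B2, B3, B4.
  assert (HCi : (Ci ^ 2 = - (1))%C).
  { unfold Ci, Cpow, Cmult, Copp, RtoC; simpl. f_equal; ring. }
  set (u1 := s3 (z0 + t)%C) in *. set (u2 := s3 (z0 + - t)%C) in *.
  set (u3 := s3 (z0 + Ci * t)%C) in *. set (u4 := s3 (z0 + - (Ci * t))%C) in *.
  match goal with |- Cmod ?X <= _ =>
    replace X with (RtoC t ^ 3 * u1 + (- RtoC t) ^ 3 * u2 + (Ci * RtoC t) ^ 3 * u3
                    + (- (Ci * RtoC t)) ^ 3 * u4)%C end.
  2:{ transitivity ((RtoC t ^ 3 * u1 + (- RtoC t) ^ 3 * u2 + (Ci * RtoC t) ^ 3 * u3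
                    + (- (Ci * RtoC t)) ^ 3 * u4) + 2 * t ^ 2 * s2 z0 * (1 + Ci ^ 2))%C.
      - rewrite HCi. ring.
      - ring. }
  assert (Hterm : forall h u : C, Cmod h = t -> Cmod u <= M -> Cmod (h ^ 3 * u)%C <= M * t ^ 3).
  { intros h u Hh Hu. rewrite Cmod_mult, Cmod_pow, Hh, Rmult_comm.
    apply Rmult_le_compat_r; [apply pow_le; lra|exact Hu]. }
  assert (F1 := Hterm _ _ A1 D1). assert (F2 := Hterm _ _ A2 D2).
  assert (F3 := Hterm _ _ A3 D3). assert (F4 := Hterm _ _ A4 D4).
  eapply Rle_trans; [apply Cmod_triangle|].
  assert (G3 := Cmod_triangle (RtoC t ^ 3 * u1 + (- RtoC t) ^ 3 * u2) ((Ci * RtoC t) ^ 3 * u3)).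
  assert (G2 := Cmod_triangle (RtoC t ^ 3 * u1) ((- RtoC t) ^ 3 * u2)).
  lra.
Qed.

Lemma Re_RtoC_mult (x : R) (z : C) : Re (x * z)%C = x * Re z.
Proof. destruct z as [a b]; simpl. ring. Qed.

(** The minimum principle.  At an interior minimum z0 of Re G - e|z|^2 the
    average over z0 + t i^k equals the value at z0 minus e t^2 up to O(t^3),
    which is too small; so the minimum lies on the circle. *)
Lemma Re_minimum_principle (G : C -> C) :
  (forall z, Cmod z <= 1 -> expands 3 G z) ->
  (forall z, Cmod z = 1 -> 0 <= Re (G z)) -> 0 <= Re (G 0%R).
Proof.
  intros Hexp Hbd. apply Rnot_lt_le. intro Hneg.
  set (e := - Re (G 0%R) / 2). assert (He : 0 < e) by (unfold e; lra).
  set (v := fun z => Re (G z) - e * Cmod z ^ 2).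
  destruct (closed_disk_minimum v) as [z0 [Hz0 Hmin]].
  { intros z Hz eps Heps.
    pose proof (expands_continuous G z (expands_le 1 3 _ _ ltac:(lia) (Hexp z Hz))
                  (eps / 2) ltac:(lra)) as H1.
    assert (H2 : near z (fun w => Cmod (w - z) < Rmin 1 (eps / 2 / (4 * e)))).
    { apply near_ball. replace (z - z)%C with (RtoC 0) by ring. rewrite Cmod_0.
      apply Rmin_pos; [lra|]. apply Rdiv_lt_0_compat; lra. }
    generalize (near_and _ _ _ H1 H2). apply near_imp. intros w [A B].
    assert (B1 := Rlt_le_trans _ _ _ B (Rmin_l _ _)).
    assert (B2 := Rlt_le_trans _ _ _ B (Rmin_r _ _)).
    assert (B3 : Cmod (w - z) * (4 * e) < eps / 2).
    { replace (eps / 2) with (eps / 2 / (4 * e) * (4 * e)) by (field; lra).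
      apply Rmult_lt_compat_r; lra. }
    assert (D1 : Rabs (Re (G w) - Re (G z)) < eps / 2).
    { eapply Rle_lt_trans; [|exact A]. eapply Rle_trans; [|apply re_le_Cmod].
      apply Req_le. reflexivity. }
    assert (D2 : Rabs (Cmod w - Cmod z) <= Cmod (w - z)).
    { assert (T1 := Cmod_triangle z (w - z)). replace (z + (w - z))%C with w in T1 by ring.
      assert (T2 := Cmod_triangle w (z - w)). replace (w + (z - w))%C with z in T2 by ring.
      replace (z - w)%C with (- (w - z))%C in T2 by ring. rewrite Cmod_opp in T2.
      apply Rabs_le. lra. }
    pose proof (Cmod_ge_0 w). pose proof (Cmod_ge_0 z).
    assert (D3 : Cmod w <= 2) by (apply Rabs_le_between in D2; lra).
    apply Rabs_def2 in D1. apply Rabs_le_between in D2.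
    pose proof (Cmod_ge_0 (w - z)) as Hn.
    assert (D4 : - (4 * Cmod (w - z)) <= Cmod w ^ 2 - Cmod z ^ 2 <= 4 * Cmod (w - z)) by nra.
    assert (D5 : e * (Cmod w ^ 2 - Cmod z ^ 2) <= e * (4 * Cmod (w - z)))
      by (apply Rmult_le_compat_l; lra).
    assert (D6 : e * (- (4 * Cmod (w - z))) <= e * (Cmod w ^ 2 - Cmod z ^ 2))
      by (apply Rmult_le_compat_l; lra).
    apply Rabs_def1; unfold v; lra. }
  destruct (Req_dec (Cmod z0) 1) as [Hc|Hc].
  { assert (H := Hmin 0%R). unfold v in H. rewrite Cmod_0, Hc in H.
    specialize (H ltac:(lra)). specialize (Hbd z0 Hc). unfold e in *. lra. }
  assert (Hlt : Cmod z0 < 1) by lra.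
  destruct (four_point_average G z0 (Hexp z0 Hz0)) as [K [d [Hd H]]].
  set (t := Rmin (d / 2) (Rmin ((1 - Cmod z0) / 2) (2 * e / (Rabs K + 1)))).
  pose proof (Rabs_pos K) as HK0.
  assert (Ht : 0 < t).
  { unfold t. repeat apply Rmin_pos; try lra. apply Rdiv_lt_0_compat; lra. }
  assert (Ht1 : t <= d / 2) by apply Rmin_l.
  assert (Ht2 : t <= (1 - Cmod z0) / 2) by (unfold t; eapply Rle_trans; [apply Rmin_r|apply Rmin_l]).
  assert (Ht3 : t <= 2 * e / (Rabs K + 1)) by (unfold t; eapply Rle_trans; [apply Rmin_r|apply Rmin_r]).
  assert (Ht4 : t * (Rabs K + 1) <= 2 * e).
  { replace (2 * e) with (2 * e / (Rabs K + 1) * (Rabs K + 1)) by (field; lra).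
    apply Rmult_le_compat_r; lra. }
  specialize (H t ltac:(lra)).
  assert (Hin : forall h : C, Cmod h = t -> v z0 <= v (z0 + h)%C).
  { intros h Hh. apply Hmin. pose proof (Cmod_triangle z0 h). lra. }
  assert (A1 : Cmod (RtoC t) = t) by (rewrite Cmod_R, Rabs_pos_eq; lra).
  assert (A2 : Cmod (- RtoC t)%C = t) by (now rewrite Cmod_opp).
  assert (A3 : Cmod (Ci * RtoC t)%C = t) by (rewrite Cmod_mult, Cmod_Ci; lra).
  assert (A4 : Cmod (- (Ci * RtoC t))%C = t) by (now rewrite Cmod_opp).
  assert (V1 := Hin _ A1). assert (V2 := Hin _ A2).
  assert (V3 := Hin _ A3). assert (V4 := Hin _ A4).
  unfold v in V1, V2, V3, V4. rewrite !Cmod2_alt in V1, V2, V3, V4.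
  assert (Hre := re_le_Cmod (G (z0 + t) + G (z0 - t) + G (z0 + Ci * t) + G (z0 - Ci * t)
                             - 4 * G z0)%C).
  assert (HRe : Re (G (z0 + t) + G (z0 - t) + G (z0 + Ci * t) + G (z0 - Ci * t)
                             - 4 * G z0)%C
    = Re (G (z0 + t)%C) + Re (G (z0 - t)%C) + Re (G (z0 + Ci * t)%C) + Re (G (z0 - Ci * t)%C)
      - 4 * Re (G z0)).
  { unfold Cminus. rewrite !re_plus.
    replace (- (4 * G z0))%C with (RtoC (-4) * G z0)%C by ring.
    rewrite Re_RtoC_mult. ring. }
  rewrite HRe in Hre. unfold Cminus in Hre, H.
  apply Rabs_le_between in Hre.
  set (S0 := Cmod _) in Hre. change (S0 <= K * t ^ 3) in H. clearbody S0.
  destruct z0 as [x y]. simpl in V1, V2, V3, V4.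
  assert (HKt : K * t ^ 3 <= (Rabs K + 1) * t * t ^ 2 - t ^ 3).
  { pose proof (Rle_abs K). assert (0 < t ^ 3) by (apply pow_lt; lra). nra. }
  assert (0 < t ^ 3) by (apply pow_lt; lra).
  assert (0 < t ^ 2) by (apply pow_lt; lra).
  set (g1 := Re (G (_ + RtoC t)%C)) in *.
  nra.
Qed.

(** * Positivity of Toeplitz forms *)

(** The Hermitian form of the 4 x 4 Toeplitz matrix with ones on the diagonal
    and first row 1, c1, c2, c3. *)
Definition toeplitz_form (c1 c2 c3 q0 q1 q2 q3 : C) : R :=
  Cmod q0 ^ 2 + Cmod q1 ^ 2 + Cmod q2 ^ 2 + Cmod q3 ^ 2 +
  2 * Re (c1 * (q0 * Cconj q1 + q1 * Cconj q2 + q2 * Cconj q3)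
          + c2 * (q0 * Cconj q2 + q1 * Cconj q3) + c3 * (q0 * Cconj q3))%C.

Ltac expands_tac :=
  repeat first [assumption | apply expands_const | apply expands_id
               | apply expands_plus | apply expands_opp | apply expands_mult
               | apply expands_pow].

Lemma Re_minus_conj (u : C) : Re (u - Cconj u)%C = 0.
Proof. destruct u; simpl. ring. Qed.

(** On the unit circle Re (p |Q|^2), for Q = q0 + q1 z + q2 z^2 + q3 z^3, agrees
    with Re G for a function G without pole at 0: multiply p by the Laurent
    polynomial |Q|^2 and reflect the principal part d1/z + d2/z^2 + d3/z^3
    across the circle.  The value of Re G at 0 is the Toeplitz form. *)
Lemma toeplitz_form_ge0_closed (p s1 s2 s3 : C -> C) (p1 p2 p3 : C) :
  (forall z, Cmod z <= 1 -> expands 3 p z /\ expands 3 s1 z /\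
                            expands 3 s2 z /\ expands 3 s3 z) ->
  (forall z, Cmod z <= 1 -> p z = 1 + z * s1 z /\ s1 z = p1 + z * s2 z /\
                            s2 z = p2 + z * s3 z)%C ->
  s3 0%R = p3 ->
  (forall z, Cmod z = 1 -> 0 <= Re (p z)) ->
  forall q0 q1 q2 q3 : C,
  0 <= toeplitz_form (p1 / 2) (p2 / 2) (p3 / 2) q0 q1 q2 q3.
Proof.
  intros Hexp Heq H3 Hpos q0 q1 q2 q3.
  set (l0 := (q0 * Cconj q0 + q1 * Cconj q1 + q2 * Cconj q2 + q3 * Cconj q3)%C).
  set (l1 := (q1 * Cconj q0 + q2 * Cconj q1 + q3 * Cconj q2)%C).
  set (l2 := (q2 * Cconj q0 + q3 * Cconj q1)%C).
  set (l3 := (q3 * Cconj q0)%C).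
  set (m1 := (q0 * Cconj q1 + q1 * Cconj q2 + q2 * Cconj q3)%C).
  set (m2 := (q0 * Cconj q2 + q1 * Cconj q3)%C).
  set (m3 := (q0 * Cconj q3)%C).
  set (d1 := (m1 + p1 * m2 + p2 * m3)%C).
  set (d2 := (m2 + p1 * m3)%C).
  set (G := fun z => (p z * (l0 + l1 * z + l2 * z ^ 2 + l3 * z ^ 3)
     + m1 * s1 z + m2 * s2 z + m3 * s3 z
     + (0 + Cconj d1 * z + Cconj d2 * z ^ 2 + Cconj m3 * z ^ 3))%C).
  assert (HG : 0 <= Re (G 0%R)).
  { apply Re_minimum_principle.
    - intros z Hz. destruct (Hexp z Hz) as [E [E1 [E2 E3]]].
      unfold G. expands_tac.
    - intros z Hz. destruct (Heq z ltac:(lra)) as [F [F1 F2]].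
      assert (Hz0 : z <> 0%R) by (intros ->; rewrite Cmod_0 in Hz; lra).
      assert (Hw : Cconj z = (/ z)%C).
      { assert (E : (z * Cconj z = 1)%C).
        { rewrite <- Cmod2_conj, Hz. simpl. f_equal. ring. }
        transitivity (/ z * (z * Cconj z))%C; [field; exact Hz0|]. rewrite E. ring. }
      set (Q := (q0 + q1 * z + q2 * z ^ 2 + q3 * z ^ 3)%C).
      set (u := (Cconj d1 * z + Cconj d2 * z ^ 2 + Cconj m3 * z ^ 3)%C).
      assert (HGz : G z = ((Q * Cconj Q) * p z + (u - Cconj u))%C).
      { assert (S1 : s1 z = ((p z - 1) / z)%C) by (rewrite F; field; exact Hz0).
        assert (S2 : s2 z = ((s1 z - p1) / z)%C) by (rewrite F1; field; exact Hz0).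
        assert (S3 : s3 z = ((s2 z - p2) / z)%C) by (rewrite F2; field; exact Hz0).
        unfold G. rewrite S3, S2, S1. unfold u, Q, d1, d2, l0, l1, l2, l3, m1, m2, m3.
        rewrite !Cplus_conj, !Cmult_conj, !Cpow_conj, !Cplus_conj, !Cmult_conj, !Cconj_conj.
        rewrite !Cplus_conj, !Cmult_conj, !Cconj_conj, !Hw.
        field. exact Hz0. }
      rewrite HGz, re_plus, Re_minus_conj, <- Cmod2_conj, Re_RtoC_mult.
      pose proof (Hpos z Hz). pose proof (pow2_ge_0 (Cmod Q)). nra. }
  assert (Z : Cmod (RtoC 0) <= 1) by (rewrite Cmod_0; lra).
  destruct (Heq _ Z) as [F [F1 F2]].
  replace (toeplitz_form _ _ _ _ _ _ _) with (Re (G 0%R)); [exact HG|].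
  unfold G. rewrite F, F1, F2, H3.
  replace (_ + _ + _ + _ + _)%C with (l0 + (p1 * m1 + p2 * m2 + p3 * m3))%C by ring.
  unfold toeplitz_form. fold m1 m2 m3.
  replace (p1 / 2 * m1 + p2 / 2 * m2 + p3 / 2 * m3)%C
    with (RtoC (/ 2) * (p1 * m1 + p2 * m2 + p3 * m3))%C.
  2:{ rewrite RtoC_inv by lra. unfold Cdiv; ring. }
  rewrite Re_RtoC_mult, re_plus. unfold l0. rewrite <- !Cmod2_conj, !re_plus.
  simpl Re. unfold RtoC; simpl. field.
Qed.

Lemma cubic_ge0_at_1 (a0 a1 a2 a3 : R) :
  (forall r, 0 < r < 1 -> 0 <= a0 + a1 * r + a2 * r ^ 2 + a3 * r ^ 3) ->
  0 <= a0 + a1 + a2 + a3.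
Proof.
  intros H. apply Rnot_lt_le. intro N.
  set (e := - (a0 + a1 + a2 + a3)). assert (He : 0 < e) by (unfold e; lra).
  set (K := Rabs a1 + 2 * Rabs a2 + 3 * Rabs a3 + e).
  pose proof (Rabs_pos a1). pose proof (Rabs_pos a2). pose proof (Rabs_pos a3).
  assert (HK : 0 < K) by (unfold K; lra).
  set (t := e / (2 * K)).
  assert (Ht : 0 < t) by (apply Rdiv_lt_0_compat; lra).
  assert (HtK : t * (2 * K) = e) by (unfold t; field; lra).
  assert (Ht1 : t < 1) by (unfold K in HtK; nra).
  assert (Hr : 0 < 1 - t < 1) by lra. apply H in Hr. clear H. rename Hr into H.
  assert (T1 : - a1 * t <= Rabs a1 * t)
    by (apply Rmult_le_compat_r; [lra|]; pose proof (Rabs_maj2 a1); lra).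
  assert (T2 : a2 * ((1 - t) ^ 2 - 1) <= Rabs a2 * (2 * t)).
  { eapply Rle_trans; [apply Rle_abs|]. rewrite Rabs_mult.
    apply Rmult_le_compat_l; [lra|]. apply Rabs_le.
    replace ((1 - t) ^ 2 - 1) with (- (2 * t) + t ^ 2) by ring.
    assert (P2 : 0 <= t ^ 2 <= t) by nra. lra. }
  assert (T3 : a3 * ((1 - t) ^ 3 - 1) <= Rabs a3 * (3 * t)).
  { eapply Rle_trans; [apply Rle_abs|]. rewrite Rabs_mult.
    apply Rmult_le_compat_l; [lra|]. apply Rabs_le.
    assert (P2 : 0 <= t ^ 2 <= t) by nra. assert (P3 : 0 <= t ^ 3 <= t ^ 2) by nra.
    replace ((1 - t) ^ 3 - 1) with (- (3 * t) + 3 * t ^ 2 - t ^ 3) by ring. lra. }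
  assert (Hte : 0 < t * e) by (now apply Rmult_lt_0_compat).
  assert (Hs : a0 + a1 + a2 + a3 = - e) by (unfold e; ring).
  unfold K in HtK. clearbody e t. lra.
Qed.

(** The quotient provided by [expands] exists only near its point; dividing by z
    gives one function on the whole disk. *)
Lemma expands_slope (n : nat) (g : C -> C) :
  (forall z, in_disk z -> expands (S n) g z) ->
  exists s : C -> C, (forall z, in_disk z -> expands n s z) /\
    forall z, in_disk z -> g z = (g 0%R + z * s z)%C.
Proof.
  intros H.
  assert (H0 : in_disk 0%R) by (unfold in_disk; rewrite Cmod_0; lra).
  destruct (H _ H0) as [s [Hs E]].
  exists (fun z => if Ceq_dec z 0%R then s 0%R else ((g z - g 0%R) / z)%C). split.
  - intros z Hz. destruct (Ceq_dec z 0%R) as [->|N].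
    + apply (expands_ext n s); [|exact Hs]. revert E. apply near_imp.
      intros w Hw. destruct (Ceq_dec w 0%R) as [->|Nw]; [reflexivity|].
      rewrite Hw. field. exact Nw.
    + apply (expands_ext n (fun w => (g w - g 0%R) / w)%C).
      * generalize (near_neq z _ N). apply near_imp. intros w Hw.
        now destruct (Ceq_dec w 0%R).
      * apply (expands_pred n). apply expands_div; [| |exact N].
        -- apply expands_minus; [now apply H|apply expands_const].
        -- apply expands_id.
  - intros z Hz. destruct (Ceq_dec z 0%R) as [->|N]; [ring|]. field. exact N.
Qed.

Lemma toeplitz_form_scale (r : R) (p1 p2 p3 q0 q1 q2 q3 : C) :
  toeplitz_form (r * p1 / 2) (r ^ 2 * p2 / 2) (r ^ 3 * p3 / 2) q0 q1 q2 q3 =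
  Cmod q0 ^ 2 + Cmod q1 ^ 2 + Cmod q2 ^ 2 + Cmod q3 ^ 2
  + Re (p1 * (q0 * Cconj q1 + q1 * Cconj q2 + q2 * Cconj q3))%C * r
  + Re (p2 * (q0 * Cconj q2 + q1 * Cconj q3))%C * r ^ 2
  + Re (p3 * (q0 * Cconj q3))%C * r ^ 3.
Proof.
  unfold toeplitz_form.
  set (m1 := (q0 * Cconj q1 + q1 * Cconj q2 + q2 * Cconj q3)%C).
  set (m2 := (q0 * Cconj q2 + q1 * Cconj q3)%C). set (m3 := (q0 * Cconj q3)%C).
  replace (r * p1 / 2 * m1)%C with (RtoC (r * / 2) * (p1 * m1))%C.
  2:{ rewrite RtoC_mult, RtoC_inv by lra. unfold Cdiv; ring. }
  replace (r ^ 2 * p2 / 2 * m2)%C with (RtoC (r ^ 2 * / 2) * (p2 * m2))%C.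
  2:{ rewrite RtoC_mult, RtoC_inv, RtoC_pow by lra. unfold Cdiv; ring. }
  replace (r ^ 3 * p3 / 2 * m3)%C with (RtoC (r ^ 3 * / 2) * (p3 * m3))%C.
  2:{ rewrite RtoC_mult, RtoC_inv, RtoC_pow by lra. unfold Cdiv; ring. }
  rewrite !re_plus, !Re_RtoC_mult. field.
Qed.

(** For p holomorphic only in the open disk, apply the closed case to
    z |-> p (r z) and let r tend to 1. *)
Lemma toeplitz_form_ge0 (p s1 s2 s3 : C -> C) (p1 p2 p3 : C) :
  (forall z, in_disk z -> expands 3 p z /\ expands 3 s1 z /\
                            expands 3 s2 z /\ expands 3 s3 z) ->
  (forall z, in_disk z -> p z = 1 + z * s1 z /\ s1 z = p1 + z * s2 z /\
                            s2 z = p2 + z * s3 z)%C ->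
  s3 0%R = p3 ->
  (forall z, in_disk z -> 0 <= Re (p z)) ->
  forall q0 q1 q2 q3 : C,
  0 <= toeplitz_form (p1 / 2) (p2 / 2) (p3 / 2) q0 q1 q2 q3.
Proof.
  intros Hexp Heq H3 Hpos q0 q1 q2 q3.
  assert (E1 := toeplitz_form_scale 1 p1 p2 p3 q0 q1 q2 q3).
  replace (1%R * p1 / 2)%C with (p1 / 2)%C in E1 by (unfold Cdiv; ring).
  replace (1%R ^ 2 * p2 / 2)%C with (p2 / 2)%C in E1 by (unfold Cdiv; ring).
  replace (1%R ^ 3 * p3 / 2)%C with (p3 / 2)%C in E1 by (unfold Cdiv; ring).
  rewrite E1, !pow1, !Rmult_1_r. apply cubic_ge0_at_1. intros r Hr.
  rewrite <- toeplitz_form_scale.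
  assert (Hd : forall z, Cmod z <= 1 -> in_disk (r * z)%C).
  { intros z Hz. unfold in_disk. rewrite Cmod_mult, Cmod_R, Rabs_pos_eq by lra.
    pose proof (Cmod_ge_0 z). nra. }
  apply (toeplitz_form_ge0_closed (fun z => p (r * z)) (fun z => r * s1 (r * z))
    (fun z => r ^ 2 * s2 (r * z)) (fun z => r ^ 3 * s3 (r * z)))%C.
  - intros z Hz. destruct (Hexp _ (Hd z Hz)) as [A [A1 [A2 A3]]].
    repeat split; try (apply expands_mult; [apply expands_const|]);
      apply (expands_scale 3); assumption.
  - intros z Hz. destruct (Heq _ (Hd z Hz)) as [A [A1 A2]].
    repeat split; [rewrite A at 1|rewrite A1 at 1|rewrite A2 at 1]; ring.
  - cbv beta. now rewrite Cmult_0_r, H3.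
  - intros z Hz. apply Hpos, Hd. lra.
Qed.

(** * The Caratheodory coefficient region *)

Lemma Cmod_le_of_rotations (X : C) (A : R) :
  (forall u : C, Cmod u = 1 -> 0 <= A + Re (Cconj u * X)%C) -> Cmod X <= A.
Proof.
  intros H. destruct (Req_dec (Cmod X) 0) as [E|N].
  - rewrite E. specialize (H 1%R Cmod_1).
    apply Cmod_eq_0 in E. subst X. rewrite Cmult_0_r in H. simpl in H. lra.
  - pose proof (Cmod_ge_0 X) as Hp. assert (Hpos : 0 < Cmod X) by lra.
    set (u := (RtoC (- / Cmod X) * X)%C).
    assert (Hu : Cmod u = 1).
    { unfold u. rewrite Cmod_mult, Cmod_R, Rabs_Ropp, Rabs_pos_eq.
      - field. lra.
      - left. now apply Rinv_0_lt_compat. }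
    specialize (H u Hu).
    replace (Cconj u * X)%C with (RtoC (- / Cmod X) * RtoC (Cmod X ^ 2))%C in H.
    + rewrite Re_RtoC_mult in H. change (Re (RtoC (Cmod X ^ 2))) with (Cmod X ^ 2) in H.
      replace (- / Cmod X * Cmod X ^ 2) with (- Cmod X) in H by (field; lra). lra.
    + rewrite Cmod2_conj. unfold u. rewrite Cmult_conj.
      replace (Cconj (RtoC (- / Cmod X))) with (RtoC (- / Cmod X)).
      * ring.
      * unfold Cconj, RtoC; simpl. now rewrite Ropp_0.
Qed.

Lemma toeplitz_form_Re (c1 c2 c3 q0 q1 q2 q3 : C) :
  toeplitz_form c1 c2 c3 q0 q1 q2 q3 =
  Re (q0 * Cconj q0 + q1 * Cconj q1 + q2 * Cconj q2 + q3 * Cconj q3)%C +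
  2 * Re (c1 * (q0 * Cconj q1 + q1 * Cconj q2 + q2 * Cconj q3)
          + c2 * (q0 * Cconj q2 + q1 * Cconj q3) + c3 * (q0 * Cconj q3))%C.
Proof. unfold toeplitz_form. rewrite <- !Cmod2_conj, !re_plus. reflexivity. Qed.

(** Caratheodory's coefficient region for three coefficients, with c_k = p_k / 2;
    lambda is the modulus of the second Schur parameter.  Each bound is the
    Cauchy-Schwarz inequality for the components of e_0 and e_k orthogonal to
    the vectors between them, in the space with Gram matrix the Toeplitz one. *)
Lemma caratheodory_region (c1 c2 c3 : C) :
  (forall q0 q1 q2 q3 : C, 0 <= toeplitz_form c1 c2 c3 q0 q1 q2 q3) ->
  Cmod c1 <= 1 /\ exists lambda, 0 <= lambda <= 1 /\
    Cmod (c2 - c1 ^ 2) <= (1 - Cmod c1 ^ 2) * lambda /\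
    Cmod c3 <= Cmod c1 ^ 3 + (1 - Cmod c1 ^ 2) *
      (2 * Cmod c1 * lambda + Cmod c1 * lambda ^ 2 + (1 - lambda ^ 2)).
Proof.
  intros H.
  assert (HA : forall u : C, Cmod u = 1 -> Re u ^ 2 + Im u ^ 2 = 1).
  { intros u Hu. rewrite <- Cmod2_alt, Hu. ring. }
  assert (B1 : Cmod c1 <= 1).
  { apply Cmod_le_of_rotations. intros u Hu. specialize (H 1%R u 0%R 0%R).
    rewrite toeplitz_form_Re in H. apply HA in Hu.
    destruct c1, c2, c3, u; simpl in *. nra. }
  assert (B3 : Cmod c3 <= 1).
  { apply Cmod_le_of_rotations. intros u Hu. specialize (H 1%R 0%R 0%R u).
    rewrite toeplitz_form_Re in H. apply HA in Hu.
    destruct c1, c2, c3, u; simpl in *. nra. }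
  split; [exact B1|].
  set (D := 1 - Cmod c1 ^ 2).
  set (v := (c2 - c1 ^ 2)%C).
  pose proof (Cmod_ge_0 c1) as K0. pose proof (Cmod_ge_0 v) as V0.
  assert (HD0 : 0 <= D) by (unfold D; nra).
  assert (HD : D = 1 - (Re c1 ^ 2 + Im c1 ^ 2)) by (unfold D; now rewrite Cmod2_alt).
  assert (B2 : Cmod v <= D).
  { apply Cmod_le_of_rotations. intros u Hu.
    specialize (H 1%R (- c1 - u * Cconj c1)%C u 0%R).
    rewrite toeplitz_form_Re in H. apply HA in Hu.
    assert (E : Re (1 * Cconj 1 + (- c1 - u * Cconj c1) * Cconj (- c1 - u * Cconj c1) +
          u * Cconj u + 0 * Cconj 0)%C +
      2 * Re (c1 * (1 * Cconj (- c1 - u * Cconj c1) + (- c1 - u * Cconj c1) * Cconj u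
                    + u * Cconj 0) +
        c2 * (1 * Cconj u + (- c1 - u * Cconj c1) * Cconj 0) + c3 * (1 * Cconj 0))%C
      = (1 + (Re u ^ 2 + Im u ^ 2)) * D + 2 * Re (Cconj u * v)%C).
    { rewrite HD. unfold v. destruct c1, c2, c3, u; simpl. ring. }
    rewrite E, Hu in H. lra. }
  destruct (Req_dec D 0) as [HDz|HDn].
  (* If |c1| = 1, the last bound reads |c3| <= 1. *)
  { exists 0. rewrite HDz in *. split; [lra|]. split; [lra|].
    assert (Cmod c1 = 1) by (unfold D in HDz; nra). rewrite H0. lra. }
  assert (HDp : 0 < D) by lra.
  set (X := (D * (c3 - 2 * c1 * v - c1 ^ 3) + Cconj c1 * v ^ 2)%C).
  assert (B4 : Cmod X <= D ^ 2 - Cmod v ^ 2).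
  { apply Cmod_le_of_rotations. intros u Hu.
    (* D e_0 - a e_1 - v e_2 is orthogonal to e_1 and e_2; its mirror image
       belongs to e_3. *)
    set (a := (c1 - Cconj c1 * c2)%C).
    specialize (H D (- a - u * Cconj v)%C (- v - u * Cconj a)%C (u * D)%C).
    rewrite toeplitz_form_Re in H. apply HA in Hu.
    match type of H with 0 <= ?T =>
      assert (E : T = (1 + (Re u ^ 2 + Im u ^ 2)) * D * (D ^ 2 - Cmod v ^ 2)
                      + 2 * D * Re (Cconj u * X)%C) end.
    { rewrite (Cmod2_alt v). unfold X, v, a. rewrite !HD.
      destruct c1, c2, c3, u; simpl. ring. }
    rewrite E, Hu in H. nra. }
  set (l := Cmod v / D).
  assert (Hl : Cmod v = D * l) by (unfold l; field; lra).
  exists l.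
  assert (Hl01 : 0 <= l <= 1) by (split; nra).
  split; [exact Hl01|]. split; [lra|].
  assert (E : (D * c3)%C = (X + (D * (2 * c1 * v + c1 ^ 3) + - (Cconj c1 * v ^ 2)))%C)
    by (unfold X; ring).
  assert (T : D * Cmod c3 <= Cmod X + (D * (2 * Cmod c1 * Cmod v + Cmod c1 ^ 3)
                                       + Cmod c1 * Cmod v ^ 2)).
  { replace (D * Cmod c3) with (Cmod (D * c3)%C)
      by (rewrite Cmod_mult, Cmod_R, Rabs_pos_eq; lra).
    rewrite E. eapply Rle_trans; [apply Cmod_triangle|]. apply Rplus_le_compat_l.
    eapply Rle_trans; [apply Cmod_triangle|]. apply Rplus_le_compat.
    - rewrite Cmod_mult, Cmod_R, Rabs_pos_eq by lra. apply Rmult_le_compat_l; [lra|].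
      eapply Rle_trans; [apply Cmod_triangle|].
      rewrite !Cmod_mult, Cmod_pow, Cmod_R, Rabs_pos_eq; lra.
    - rewrite Cmod_opp, Cmod_mult, Cmod_conj, Cmod_pow. lra. }
  rewrite Hl in T, B4. set (k := Cmod c1) in *.
  apply (Rmult_le_reg_l D); [exact HDp|]. fold D.
  eapply Rle_trans; [exact T|]. eapply Rle_trans; [apply Rplus_le_compat_r; exact B4|].
  apply Req_le. ring.
Qed.

(** * Regularity of the alpha-convexity functional *)

Definition local_series (c : nat -> C) (r : R) (F : C -> C) : Prop :=
  0 < r /\ forall h, Cmod h < r -> is_pseries (c : nat -> C_NormedModule) h (F h).

Lemma local_series_0 c r F : local_series c r F -> F 0%R = c 0%nat.
Proof. intros [Hr H]. exact (proj1 (pseries_shift c r F Hr H)). Qed.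

Lemma local_series_shift c r F : local_series c r F ->
  exists G, local_series (fun n => c (S n)) r G /\
    forall h, Cmod h < r -> F h = (c 0%nat + h * G h)%C.
Proof.
  intros [Hr H]. destruct (pseries_shift c r F Hr H) as [_ [G [HG E]]].
  exists G. split; [split|]; assumption.
Qed.

Lemma local_series_C_derive c r F :
  local_series c r F -> local_series (derived_coefficients c) r (C_derive F).
Proof.
  intros [Hr H]. split; [exact Hr|]. intros h Hh.
  assert (E := is_pseries_C_derive F 0%R c r).
  replace h with (h - 0%R)%C at 1 by ring. apply E.
  - intros z Hz. replace (z - 0%R)%C with z in * by ring. now apply H.
  - now replace (h - 0%R)%C with h by ring.
Qed.

Lemma local_series_expands n c r F : local_series c r F -> expands n F 0%R.
Proof.
  intros [Hr H]. apply (pseries_expands n c r F 0%R Hr). intros z Hz.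
  replace (z - 0%R)%C with z in * by ring. now apply H.
Qed.

Lemma local_series_factor k c r F :
  local_series c r F -> (forall j, (j < k)%nat -> c j = 0%R) ->
  exists G, local_series (fun n => c (k + n)%nat) r G /\
    forall h, Cmod h < r -> F h = (h ^ k * G h)%C.
Proof.
  revert c F. induction k as [|k IH]; intros c F H Hz.
  - exists F. split; [exact H|]. intros h _. simpl. ring.
  - destruct (local_series_shift c r F H) as [G [HG E]].
    destruct (IH _ G HG) as [K [HK E']].
    + intros j Hj. apply Hz. lia.
    + exists K. split; [exact HK|]. intros h Hh.
      rewrite E, E', (Hz 0%nat) by (lia || assumption). rewrite Cpow_S. ring.
Qed.

Lemma local_series_zero c r F : local_series c r F -> (forall n, c n = 0%R) ->
  forall h, Cmod h < r -> F h = 0%R.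
Proof.
  intros [Hr H] Hz h Hh. apply Cmod_eq_0.
  assert (A := proj1 (is_pseries_Cpow _ _ _) (H h Hh)).
  apply Rle_antisym; [|apply Cmod_ge_0].
  apply (Cmod_is_series_le _ (fun n => 0 * (/ 2) ^ n) _ _ A).
  - intro n. rewrite Hz, Cmult_0_l, Cmod_0. lra.
  - assert (G := geometric_majorant 0 (/ 2) ltac:(lra)).
    rewrite Rmult_0_l in G. exact G.
Qed.

(** A univalent function is not locally constant, so f' has a zero of finite
    order k at a critical point; there f' = h^k u and f'' = h^(k-1) w with
    w / u equal to k at the point. *)
Lemma critical_point_expansion (f : C -> C) (z0 : C) :
  univalent_in_disk f -> in_disk z0 -> C_derive f z0 = 0%R ->
  exists (k : nat) (y : C -> C), (0 < k)%nat /\ expands 0 y 0%R /\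
    near 0%R (fun h => h <> 0%R ->
      C_derive (C_derive f) (z0 + h)%C / C_derive f (z0 + h)%C
      = INR k / h + y h)%C.
Proof.
  intros [Hf Hinj] Hz0 Hd.
  destruct (Hf z0 Hz0) as [c [r [Hr Hser]]].
  assert (Hd1 := is_pseries_C_derive f z0 c r Hser).
  assert (Hd2 := is_pseries_C_derive (C_derive f) z0 _ r Hd1).
  assert (L : forall b F, (forall z, Cmod (z - z0) < r ->
              is_pseries (b : nat -> C_NormedModule) (z - z0)%C (F z)) ->
              local_series b r (fun h => F (z0 + h)%C)).
  { intros b F H. split; [exact Hr|]. intros h Hh.
    replace h with (z0 + h - z0)%C at 1 by ring. apply H.
    now replace (z0 + h - z0)%C with h by ring. }
  assert (L0 := L _ _ Hser). assert (L1 := L _ _ Hd1). assert (L2 := L _ _ Hd2).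
  clear L Hser Hd1 Hd2. set (d := derived_coefficients c) in *.
  assert (Hk : exists k, d k <> 0%R /\ forall j, (j < k)%nat -> d j = 0%R).
  { assert (He : exists n, d n <> 0%R).
    { apply NNPP. intro N.
      assert (Hc : forall n, c (S n) = 0%R).
      { intro n. destruct (classic (d n = 0%R)) as [E|E]; [|exfalso; eauto].
        unfold d, derived_coefficients in E.
        assert (HS : RtoC (INR (S n)) <> 0%R).
        { intro A. apply RtoC_inj in A. revert A. apply not_0_INR. lia. }
        transitivity (/ INR (S n) * (INR (S n) * c (S n)))%C; [field; exact HS|].
        rewrite E. ring. }
      destruct (local_series_shift _ _ _ L0) as [G [HG E]].
      assert (HG0 := local_series_zero _ _ _ HG Hc).
      destruct (near_in_disk z0 Hz0) as [e [He HD]].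
      set (t := Rmin (r / 2) (e / 2)).
      assert (Ht : 0 < t) by (unfold t; apply Rmin_pos; lra).
      assert (Ht1 : t <= r / 2) by apply Rmin_l. assert (Ht2 : t <= e / 2) by apply Rmin_r.
      assert (Hmt : Cmod (RtoC t) = t) by (rewrite Cmod_R, Rabs_pos_eq; lra).
      assert (Heq : (z0 + RtoC t)%C = z0).
      { apply Hinj.
        - apply HD. replace (z0 + RtoC t - z0)%C with (RtoC t) by ring. lra.
        - exact Hz0.
        - rewrite E, HG0 by lra. rewrite Cmult_0_r, Cplus_0_r.
          rewrite <- (local_series_0 _ _ _ L0). now rewrite Cplus_0_r. }
      assert (E0 : RtoC t = 0%R).
      { transitivity (z0 + RtoC t - z0)%C; [ring|]. rewrite Heq. ring. }
      apply RtoC_inj in E0. lra. }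
    destruct (dec_inh_nat_subset_has_unique_least_element (fun n => d n <> 0%R))
      as [k [[Hk Hmin] _]]; [intro; apply classic|exact He|].
    exists k. split; [exact Hk|]. intros j Hj. apply NNPP. intro N.
    specialize (Hmin j N). lia. }
  destruct Hk as [k [Hdk Hmin]].
  assert (Hd0 : d 0%nat = 0%R).
  { rewrite <- (local_series_0 _ _ _ L1), Cplus_0_r. exact Hd. }
  destruct k as [|k]; [contradiction|].
  destruct (local_series_factor (S k) _ _ _ L1 Hmin) as [u [Lu Eu]].
  destruct (local_series_factor k _ _ _ L2) as [w [Lw Ew]].
  { intros j Hj. unfold derived_coefficients at 1. rewrite Hmin by lia. ring. }
  assert (Hu0 : u 0%R <> 0%R).
  { rewrite (local_series_0 _ _ _ Lu), Nat.add_0_r. exact Hdk. }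
  assert (Hw0 : w 0%R = (INR (S k) * u 0%R)%C).
  { rewrite (local_series_0 _ _ _ Lu), (local_series_0 _ _ _ Lw), !Nat.add_0_r.
    reflexivity. }
  assert (Hq : expands 1 (fun h => w h / u h)%C 0%R).
  { apply expands_div; [| |exact Hu0]; eapply local_series_expands; eassumption. }
  assert (Hun := expands_near_neq0 u 0%R (local_series_expands 1 _ _ _ Lu) Hu0).
  assert (Hball : near 0%R (fun h => Cmod h < r)).
  { exists r. split; [exact Hr|]. intros h Hh. now replace (h - 0%R)%C with h in Hh by ring. }
  destruct Hq as [y [Hy Ey]].
  exists (S k), y. split; [lia|]. split; [exact Hy|].
  generalize (near_and _ _ _ Hun (near_and _ _ _ Hball Ey)). apply near_imp.
  intros h [A [B E]] Hh.
  rewrite (Eu h B), (Ew h B).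
  assert (E' : (w h / u h = INR (S k) + h * y h)%C).
  { rewrite E, Hw0. field. exact Hu0. }
  transitivity (w h / u h / h)%C.
  - rewrite Cpow_S. field. repeat split; try assumption. now apply Cpow_nz.
  - rewrite E'. field. exact Hh.
Qed.

Lemma log_derivative_expands_away (n : nat) (f : C -> C) (z0 : C) :
  univalent_in_disk f -> f 0%R = 0%R -> in_disk z0 -> z0 <> 0%R ->
  expands n (log_derivative f) z0.
Proof.
  intros [Hf Hinj] H0 Hz0 N.
  assert (Hfz : f z0 <> 0%R).
  { rewrite <- H0. intro E. apply N. apply Hinj; [exact Hz0| |exact E].
    unfold in_disk. rewrite Cmod_0. lra. }
  apply (expands_ext n (fun z => z * C_derive f z / f z)%C).
  - generalize (near_neq z0 _ N). apply near_imp. intros z Hz.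
    unfold log_derivative. now destruct (Ceq_dec z 0%R).
  - apply (expands_pred n). apply expands_div; [| |exact Hfz].
    + apply expands_mult; [apply expands_id|].
      apply analytic_expands, analytic_at_C_derive, Hf, Hz0.
    + apply analytic_expands, Hf, Hz0.
Qed.

(** At a zero z0 of f' of order k, z f''/f' has a pole with principal part
    k z0 / (z - z0); approaching z0 radially from inside makes its real part
    tend to minus infinity. *)
Lemma alpha_convex_derivative_neq0 (alpha beta : R) (f : C -> C) (z0 : C) :
  0 < alpha -> univalent_in_disk f -> f 0%R = 0%R ->
  alpha_convex_of_order alpha beta f -> in_disk z0 -> z0 <> 0%R ->
  C_derive f z0 <> 0%R.
Proof.
  intros Ha Hf H0 Hconv Hz0 N Hcrit.
  destruct (critical_point_expansion f z0 Hf Hz0 Hcrit) as [k [y [Hk [[M HM] E]]]].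
  destruct (log_derivative_expands_away 0 f z0 Hf H0 Hz0 N) as [L HL].
  destruct (near_and _ _ _ (near_in_disk z0 Hz0) HL) as [d1 [Hd1 A1]].
  destruct (near_and _ _ _ HM E) as [d2 [Hd2 A2]].
  assert (Hm : 0 < Cmod z0) by now apply Cmod_gt_0.
  assert (Hm1 : Cmod z0 < 1) by exact Hz0.
  set (B := Rabs (1 - alpha) * Rabs L + alpha + alpha * INR k + alpha * Rabs M
            + Rabs beta + 1).
  assert (HB : 0 < B).
  { unfold B. pose proof (Rabs_pos (1 - alpha)). pose proof (Rabs_pos L).
    pose proof (Rabs_pos M). pose proof (Rabs_pos beta). pose proof (pos_INR k).
    assert (0 <= Rabs (1 - alpha) * Rabs L) by (now apply Rmult_le_pos).
    assert (0 <= alpha * Rabs M) by (apply Rmult_le_pos; lra).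
    assert (0 <= alpha * INR k) by (apply Rmult_le_pos; lra). lra. }
  set (t := Rmin (Rmin (d1 / 2) (d2 / 2)) (Rmin 1 (alpha / B))).
  assert (HaB : 0 < alpha / B) by (now apply Rdiv_lt_0_compat).
  assert (Ht : 0 < t) by (unfold t; repeat apply Rmin_pos; lra).
  assert (Ht4 : t <= d1 / 2 /\ t <= d2 / 2 /\ t <= 1 /\ t <= alpha / B).
  { unfold t. pose proof (Rmin_l (Rmin (d1 / 2) (d2 / 2)) (Rmin 1 (alpha / B))).
    pose proof (Rmin_r (Rmin (d1 / 2) (d2 / 2)) (Rmin 1 (alpha / B))).
    pose proof (Rmin_l (d1 / 2) (d2 / 2)). pose proof (Rmin_r (d1 / 2) (d2 / 2)).
    pose proof (Rmin_l 1 (alpha / B)). pose proof (Rmin_r 1 (alpha / B)). lra. }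
  set (h := (RtoC (- t) * z0)%C).
  assert (Hh : Cmod h = t * Cmod z0).
  { unfold h. rewrite Cmod_mult, Cmod_R, Rabs_Ropp, Rabs_pos_eq; lra. }
  assert (Hht : Cmod h < d1 /\ Cmod h < d2 /\ 0 < Cmod h) by (rewrite Hh; nra).
  destruct (A1 (z0 + h)%C) as [B1 B2].
  { replace (z0 + h - z0)%C with h by ring. lra. }
  destruct (A2 h) as [B3 B4].
  { replace (h - 0%R)%C with h by ring. lra. }
  assert (Hh0 : h <> 0%R) by (apply Cmod_gt_0; lra).
  specialize (B4 Hh0). specialize (Hconv (z0 + h)%C B1).
  unfold alpha_convex_functional in Hconv.
  assert (Ht0 : RtoC t <> 0%R) by (intro A; apply RtoC_inj in A; lra).
  assert (Hq : ((z0 + h) * C_derive (C_derive f) (z0 + h) / C_derive f (z0 + h)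
               = RtoC (INR k * (1 - / t)) + (z0 + h) * y h)%C).
  { unfold Cdiv in *. rewrite <- Cmult_assoc, B4.
    rewrite RtoC_mult, RtoC_minus, RtoC_inv by lra. unfold h. rewrite RtoC_opp.
    field. split; [exact Ht0|exact N]. }
  rewrite Hq in Hconv.
  set (lg := log_derivative f (z0 + h)%C) in *.
  set (rest := ((z0 + h) * y h)%C) in *.
  rewrite re_plus, !Re_RtoC_mult, !re_plus in Hconv.
  change (Re (RtoC 1)) with 1 in Hconv.
  change (Re (RtoC (INR k * (1 - / t)))) with (INR k * (1 - / t)) in Hconv.
  assert (R1 : Rabs (Re lg) <= Rabs L).
  { eapply Rle_trans; [apply re_le_Cmod|].
    eapply Rle_trans; [exact B2|apply Rle_abs]. }
  assert (R2 : (1 - alpha) * Re lg <= Rabs (1 - alpha) * Rabs L).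
  { eapply Rle_trans; [apply Rle_abs|]. rewrite Rabs_mult.
    apply Rmult_le_compat_l; [apply Rabs_pos|exact R1]. }
  assert (R3 : Re rest <= Rabs M).
  { eapply Rle_trans; [apply Rle_abs|]. eapply Rle_trans; [apply re_le_Cmod|].
    unfold rest. rewrite Cmod_mult. unfold in_disk in B1.
    pose proof (Cmod_ge_0 (y h)). pose proof (Cmod_ge_0 (z0 + h)). pose proof (Rle_abs M).
    nra. }
  assert (Hk1 : 1 <= INR k) by (apply (le_INR 1 k); lia).
  assert (HtB : B <= alpha * / t).
  { apply (Rmult_le_reg_r t); [exact Ht|]. rewrite Rmult_assoc, Rinv_l, Rmult_1_r by lra.
    replace alpha with (B * (alpha / B)) by (field; lra).
    apply Rmult_le_compat_l; lra. }
  assert (HtB' : alpha * / t <= alpha * (INR k * / t)).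
  { apply Rmult_le_compat_l; [lra|].
    assert (0 < / t) by (now apply Rinv_0_lt_compat). nra. }
  assert (R4 : alpha * Re rest <= alpha * Rabs M) by (apply Rmult_le_compat_l; lra).
  pose proof (Rabs_maj2 beta). unfold B in HtB. nra.
Qed.

Lemma alpha_convex_functional_expands (n : nat) (alpha beta : R) (f : C -> C)
  (c : nat -> C) (r : R) :
  0 <= alpha -> univalent_in_disk f -> local_series c r f ->
  c 0%nat = 0%R -> c 1%nat = 1%R -> alpha_convex_of_order alpha beta f ->
  forall z, in_disk z -> expands n (alpha_convex_functional alpha f) z.
Proof.
  intros Ha Hf Hser Hc0 Hc1 Hconv z Hz.
  assert (H0 : f 0%R = 0%R) by (rewrite (local_series_0 _ _ _ Hser); exact Hc0).
  assert (Hd0 : C_derive f 0%R = 1%R).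
  { rewrite (local_series_0 _ _ _ (local_series_C_derive _ _ _ Hser)).
    unfold derived_coefficients. rewrite Hc1. simpl. ring. }
  assert (Hlog : expands n (log_derivative f) z).
  { destruct (Ceq_dec z 0%R) as [->|N]; [|now apply log_derivative_expands_away].
    destruct (local_series_shift _ _ _ Hser) as [phi [Hphi E]].
    assert (Hp0 : phi 0%R = 1%R) by (rewrite (local_series_0 _ _ _ Hphi); exact Hc1).
    assert (Hp0' : phi 0%R <> 0%R).
    { rewrite Hp0. intro A. apply RtoC_inj in A. lra. }
    apply (expands_ext n (fun z => C_derive f z / phi z)%C).
    - assert (Hball : near 0%R (fun h => Cmod h < r)).
      { exists r. split; [apply Hser|]. intros h Hh.
        now replace (h - 0%R)%C with h in Hh by ring. }
      generalize (near_and _ _ _ Hball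
        (expands_near_neq0 phi 0%R (local_series_expands 1 _ _ _ Hphi) Hp0')).
      apply near_imp. intros w [A B]. unfold log_derivative.
      destruct (Ceq_dec w 0%R) as [->|N].
      + rewrite Hd0, Hp0. field.
      + rewrite (E w A), Hc0. field. repeat split; try assumption.
    - apply (expands_pred n). apply expands_div; [| |exact Hp0'].
      + eapply local_series_expands, local_series_C_derive, Hser.
      + eapply local_series_expands, Hphi. }
  destruct (Req_dec alpha 0) as [->|Na].
  { apply (expands_ext n (log_derivative f)); [|exact Hlog].
    exists 1. split; [lra|]. intros w _. unfold alpha_convex_functional.
    rewrite Rminus_0_r. ring. }
  assert (Hdz : C_derive f z <> 0%R).
  { destruct (Ceq_dec z 0%R) as [->|N].
    - rewrite Hd0. intro A. apply RtoC_inj in A. lra.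
    - apply (alpha_convex_derivative_neq0 alpha beta); trivial. lra. }
  assert (Hf1 : analytic_at (C_derive f) z) by (apply analytic_at_C_derive, Hf, Hz).
  assert (Hf2 := analytic_at_C_derive _ _ Hf1).
  unfold alpha_convex_functional.
  apply expands_plus; (apply expands_mult; [apply expands_const|]); [exact Hlog|].
  apply expands_plus; [apply expands_const|].
  apply (expands_pred n). apply expands_div; [| |exact Hdz].
  - apply expands_mult; [apply expands_id|]. now apply analytic_expands.
  - now apply analytic_expands.
Qed.

(** * Comparison of Taylor coefficients *)

(** The value at 0 is left out, so that quotients such as f(z)/z need no
    convention there. *)
Definition jet (F : C -> C) (c0 c1 c2 c3 : C) : Prop :=
  exists R : C -> C, expands 0 R 0%R /\
    near 0%R (fun z => z <> 0%R ->
      F z = c0 + c1 * z + c2 * z ^ 2 + c3 * z ^ 3 + z ^ 4 * R z)%C.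

Lemma jet_ext F G c0 c1 c2 c3 :
  near 0%R (fun z => z <> 0%R -> F z = G z) -> jet F c0 c1 c2 c3 -> jet G c0 c1 c2 c3.
Proof.
  intros E [R [HR H]]. exists R. split; [exact HR|].
  generalize (near_and _ _ _ E H). apply near_imp. intros z [A B] N.
  rewrite <- A by exact N. now apply B.
Qed.

Lemma jet_const c : jet (fun _ => c) c 0%R 0%R 0%R.
Proof.
  exists (fun _ => RtoC 0). split; [apply expands_const|].
  exists 1. split; [lra|]. intros; ring.
Qed.

Lemma jet_id : jet (fun z => z) 0%R 1%R 0%R 0%R.
Proof.
  exists (fun _ => RtoC 0). split; [apply expands_const|].
  exists 1. split; [lra|]. intros; ring.
Qed.

Lemma jet_plus F G c0 c1 c2 c3 d0 d1 d2 d3 :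
  jet F c0 c1 c2 c3 -> jet G d0 d1 d2 d3 ->
  jet (fun z => F z + G z)%C (c0 + d0)%C (c1 + d1)%C (c2 + d2)%C (c3 + d3)%C.
Proof.
  intros [R [HR E]] [S [HS F']]. exists (fun z => R z + S z)%C.
  split; [now apply expands_plus|].
  generalize (near_and _ _ _ E F'). apply near_imp. intros z [A B] N.
  rewrite A, B by exact N. ring.
Qed.

Lemma jet_mult F G c0 c1 c2 c3 d0 d1 d2 d3 :
  jet F c0 c1 c2 c3 -> jet G d0 d1 d2 d3 ->
  jet (fun z => F z * G z)%C (c0 * d0)%C (c0 * d1 + c1 * d0)%C
    (c0 * d2 + c1 * d1 + c2 * d0)%C (c0 * d3 + c1 * d2 + c2 * d1 + c3 * d0)%C.
Proof.
  intros [R [HR E]] [S [HS F']].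
  exists (fun z => (c1 * d3 + c2 * d2 + c3 * d1) + (c2 * d3 + c3 * d2) * z
            + c3 * d3 * z ^ 2
            + (c0 + c1 * z + c2 * z ^ 2 + c3 * z ^ 3) * S z
            + (d0 + d1 * z + d2 * z ^ 2 + d3 * z ^ 3) * R z
            + z ^ 4 * (R z * S z))%C.
  split; [expands_tac|].
  generalize (near_and _ _ _ E F'). apply near_imp. intros z [A B] N.
  rewrite A, B by exact N. ring.
Qed.

Lemma vanishing_constant_term (c : C) (S : C -> C) :
  expands 0 S 0%R -> near 0%R (fun z => z <> 0%R -> (c + z * S z = 0)%C) ->
  c = 0%R /\ near 0%R (fun z => z <> 0%R -> S z = 0%R).
Proof.
  intros [M HM] E.
  assert (Hc : c = 0%R).
  { apply Cmod_eq_0. apply Rle_antisym; [|apply Cmod_ge_0]. apply Rnot_lt_le. intro N.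
    destruct (near_and _ _ _ HM E) as [d [Hd H]].
    pose proof (Rabs_pos M).
    set (t := Rmin (d / 2) (Cmod c / 2 / (Rabs M + 1))).
    assert (Ht : 0 < t).
    { unfold t. apply Rmin_pos; [lra|]. apply Rdiv_lt_0_compat; lra. }
    assert (Ht1 : t <= d / 2) by apply Rmin_l.
    assert (Ht2 : t <= Cmod c / 2 / (Rabs M + 1)) by apply Rmin_r.
    assert (Ht3 : t * (Rabs M + 1) <= Cmod c / 2).
    { replace (Cmod c / 2) with (Cmod c / 2 / (Rabs M + 1) * (Rabs M + 1)) by (field; lra).
      apply Rmult_le_compat_r; lra. }
    assert (Hmt : Cmod (RtoC t) = t) by (rewrite Cmod_R, Rabs_pos_eq; lra).
    destruct (H (RtoC t)) as [A B].
    { replace (RtoC t - 0%R)%C with (RtoC t) by ring. lra. }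
    assert (Ht0 : RtoC t <> 0%R) by (intro A'; apply RtoC_inj in A'; lra).
    specialize (B Ht0).
    assert (Hct : c = (- (RtoC t * S (RtoC t)))%C).
    { transitivity (c + t * S t - t * S t)%C; [ring|]. rewrite B. ring. }
    assert (Hcm : Cmod c = t * Cmod (S (RtoC t))).
    { rewrite Hct at 1. now rewrite Cmod_opp, Cmod_mult, Hmt. }
    pose proof (Rle_abs M). pose proof (Cmod_ge_0 (S (RtoC t))). nra. }
  split; [exact Hc|]. revert E. apply near_imp. intros z H N.
  specialize (H N). subst c. rewrite Cplus_0_l in H.
  transitivity (/ z * (z * S z))%C; [field; exact N|]. rewrite H. ring.
Qed.

Lemma jet_unique F c0 c1 c2 c3 d0 d1 d2 d3 :
  jet F c0 c1 c2 c3 -> jet F d0 d1 d2 d3 ->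
  c0 = d0 /\ c1 = d1 /\ c2 = d2 /\ c3 = d3.
Proof.
  intros [R [HR E]] [S [HS F']].
  assert (E0 : near 0%R (fun z => z <> 0%R ->
    ((c0 - d0) + z * ((c1 - d1) + z * ((c2 - d2) + z * ((c3 - d3)
      + z * (R z - S z)))) = 0)%C)).
  { generalize (near_and _ _ _ E F'). apply near_imp. intros z [A B] N.
    specialize (A N). specialize (B N).
    transitivity (F z - F z)%C; [rewrite A at 1; rewrite B|]; ring. }
  apply vanishing_constant_term in E0; [|expands_tac]. destruct E0 as [H0 E0].
  apply vanishing_constant_term in E0; [|expands_tac]. destruct E0 as [H1 E0].
  apply vanishing_constant_term in E0; [|expands_tac]. destruct E0 as [H2 E0].
  apply vanishing_constant_term in E0; [|expands_tac]. destruct E0 as [H3 _].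
  assert (K : forall x y : C, (x - y)%C = 0%R -> x = y).
  { intros x y H. transitivity (x - y + y)%C; [ring|]. rewrite H. ring. }
  repeat split; now apply K.
Qed.

Lemma local_series_remainder c r F : local_series c r F ->
  exists R, local_series (fun n => c (4 + n)%nat) r R /\
    forall h, Cmod h < r -> F h = (c 0%nat + c 1%nat * h + c 2%nat * h ^ 2
      + c 3%nat * h ^ 3 + h ^ 4 * R h)%C.
Proof.
  intros H.
  destruct (local_series_shift _ _ _ H) as [F1 [H1 E1]].
  destruct (local_series_shift _ _ _ H1) as [F2 [H2 E2]].
  destruct (local_series_shift _ _ _ H2) as [F3 [H3 E3]].
  destruct (local_series_shift _ _ _ H3) as [F4 [H4 E4]].
  exists F4. split; [exact H4|]. intros h Hh.
  rewrite E1, E2, E3, E4 by exact Hh. ring.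
Qed.

Lemma near_0_ball r : 0 < r -> near 0%R (fun h => Cmod h < r).
Proof.
  intros Hr. exists r. split; [exact Hr|]. intros h Hh.
  now replace (h - 0%R)%C with h in Hh by ring.
Qed.

Lemma local_series_jet c r F : local_series c r F ->
  jet F (c 0%nat) (c 1%nat) (c 2%nat) (c 3%nat).
Proof.
  intros H. destruct (local_series_remainder c r F H) as [R [HR E]].
  exists R. split; [eapply local_series_expands, HR|].
  generalize (near_0_ball r (proj1 H)). apply near_imp. intros z Hz _. now apply E.
Qed.

(** Compare coefficients in g(w)/w * f(g(w))/g(w) = 1. *)
Lemma inverse_coefficients (f g : C -> C) (a b : nat -> C) (r s : R) :
  local_series a r f -> local_series b s g ->
  a 0%nat = 0%R -> a 1%nat = 1%R -> b 0%nat = 0%R ->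
  near 0%R (fun w => f (g w) = w) ->
  b 1%nat = 1%R /\ b 2%nat = (- a 2%nat)%C /\
  b 3%nat = (2 * a 2%nat ^ 2 - a 3%nat)%C /\
  b 4%nat = (- (5 * a 2%nat ^ 3 - 5 * a 2%nat * a 3%nat + a 4%nat))%C.
Proof.
  intros Hf Hg Ha0 Ha1 Hb0 Hfg.
  destruct (local_series_shift _ _ _ Hf) as [phi [Hphi Ef]].
  destruct (local_series_shift _ _ _ Hg) as [gam [Hgam Eg]].
  destruct (local_series_remainder _ _ _ Hphi) as [A [HA EA]].
  assert (Hg0 : g 0%R = 0%R) by (rewrite (local_series_0 _ _ _ Hg); exact Hb0).
  assert (Hgc : forall e, 0 < e -> near 0%R (fun w => Cmod (g w) < e)).
  { intros e He.
    generalize (expands_continuous g 0%R (local_series_expands 1 _ _ _ Hg) e He).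
    apply near_imp. intros w Hw. rewrite Hg0 in Hw.
    now replace (g w - 0%R)%C with (g w) in Hw by ring. }
  assert (Jg := local_series_jet _ _ _ Hgam).
  (* phi o g = a1 + a2 w gam + a3 (w gam)^2 + a4 (w gam)^3 + O(w^4) *)
  assert (Jwg := jet_mult _ _ _ _ _ _ _ _ _ _ jet_id Jg).
  assert (JR : jet (fun w => g w ^ 4 * A (g w))%C 0%R 0%R 0%R 0%R).
  { exists (fun w => gam w ^ 4 * A (g w))%C. split.
    - apply expands_mult; [apply expands_pow; eapply local_series_expands, Hgam|].
      destruct (local_series_expands 0 _ _ _ HA) as [M [d [Hd HM]]].
      exists M. generalize (Hgc d Hd). apply near_imp. intros w Hw. apply HM.
      now replace (g w - 0%R)%C with (g w) by ring.
    - generalize (near_0_ball s (proj1 Hg)). apply near_imp. intros w Hw _.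
      rewrite (Eg w Hw) at 1. rewrite Hb0. ring. }
  assert (J := jet_plus _ _ _ _ _ _ _ _ _ _
    (jet_plus _ _ _ _ _ _ _ _ _ _
    (jet_plus _ _ _ _ _ _ _ _ _ _
    (jet_plus _ _ _ _ _ _ _ _ _ _
       (jet_const (a 1%nat))
       (jet_mult _ _ _ _ _ _ _ _ _ _ (jet_const (a 2%nat)) Jwg))
       (jet_mult _ _ _ _ _ _ _ _ _ _ (jet_const (a 3%nat))
          (jet_mult _ _ _ _ _ _ _ _ _ _ Jwg Jwg)))
       (jet_mult _ _ _ _ _ _ _ _ _ _ (jet_const (a 4%nat))
          (jet_mult _ _ _ _ _ _ _ _ _ _ Jwg (jet_mult _ _ _ _ _ _ _ _ _ _ Jwg Jwg))))
    JR).
  assert (J1 := jet_mult _ _ _ _ _ _ _ _ _ _ Jg J).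
  assert (J2 : jet (fun _ => RtoC 1) 1%R 0%R 0%R 0%R) by apply jet_const.
  eapply jet_ext in J1.
  - destruct (jet_unique _ _ _ _ _ _ _ _ _ J1 J2) as [X0 [X1 [X2 X3]]].
    clear J J1 J2 Jg Jwg JR.
    rewrite Ha1 in *.
    assert (Y1 : b 1%nat = 1%R) by (rewrite <- X0; ring).
    split; [exact Y1|]. rewrite Y1 in *.
    assert (Y2 : b 2%nat = (- a 2%nat)%C).
    { transitivity (b 2%nat - 0%R)%C; [ring|]. rewrite <- X1. ring. }
    split; [exact Y2|]. rewrite Y2 in *.
    assert (Y3 : b 3%nat = (2 * a 2%nat ^ 2 - a 3%nat)%C).
    { transitivity (b 3%nat - 0%R)%C; [ring|]. rewrite <- X2. ring. }
    split; [exact Y3|]. rewrite Y3 in *.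
    transitivity (b 4%nat - 0%R)%C; [ring|]. rewrite <- X3. ring.
  - generalize (near_and _ _ _ (near_0_ball s (proj1 Hg))
                 (near_and _ _ _ (Hgc r (proj1 Hf)) Hfg)).
    apply near_imp. intros w [B1 [B2 B3]] N. cbv beta.
    assert (EE := EA (g w) B2). cbv beta in EE.
    assert (E2 := Ef (g w) B2). rewrite B3, Ha0 in E2.
    assert (E3 := Eg w B1). rewrite Hb0 in E3.
    assert (E4 : (w * gam w)%C = g w) by (rewrite E3; ring).
    rewrite E4.
    match goal with |- (_ * ?T)%C = _ => replace T with (phi (g w)) end.
    2:{ rewrite EE. ring. }
    transitivity (/ w * (w * gam w) * phi (g w))%C; [field; exact N|].
    rewrite E4. transitivity (/ w * (0%R + g w * phi (g w)))%C; [ring|].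
    rewrite <- E2. field. exact N.
Qed.

(** The normalized functional p = (H - beta)/(1 - beta) has nonnegative real
    part; comparing coefficients in H f' (f/z) = (1 - alpha) f'^2 +
    alpha (f' + z f'') (f/z) expresses its first coefficients 2 p1, 2 p2, 2 p3
    by those of f. *)
Lemma alpha_convex_coefficient_region (alpha beta : R) (f : C -> C) (c : nat -> C) (r : R) :
  0 <= alpha -> beta < 1 -> univalent_in_disk f -> local_series c r f ->
  c 0%nat = 0%R -> c 1%nat = 1%R -> alpha_convex_of_order alpha beta f ->
  exists p1 p2 p3 : C,
    (forall q0 q1 q2 q3 : C, 0 <= toeplitz_form p1 p2 p3 q0 q1 q2 q3) /\
    ((1 + alpha) * c 2%nat = 2 * (1 - beta) * p1)%C /\
    ((2 + 4 * alpha) * c 3%nat - (1 + 3 * alpha) * c 2%nat ^ 2 = 2 * (1 - beta) * p2)%C /\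
    ((3 + 9 * alpha) * c 4%nat - (3 + 15 * alpha) * c 2%nat * c 3%nat
      + (1 + 7 * alpha) * c 2%nat ^ 3 = 2 * (1 - beta) * p3)%C.
Proof.
  intros Ha Hb Hf Hser Hc0 Hc1 Hconv.
  set (H := alpha_convex_functional alpha f).
  assert (HB0 : (1 - beta)%C <> 0%R).
  { rewrite <- RtoC_minus. intro A. apply RtoC_inj in A. lra. }
  set (p := fun z => ((H z - beta) / (1 - beta))%C).
  assert (H0 : f 0%R = 0%R) by (rewrite (local_series_0 _ _ _ Hser); exact Hc0).
  assert (Hdisk0 : in_disk 0%R) by (unfold in_disk; rewrite Cmod_0; lra).
  assert (Hp : forall n z, in_disk z -> expands n p z).
  { intros n z Hz. unfold p, Cdiv. apply expands_mult; [|apply expands_const].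
    apply expands_minus; [|apply expands_const].
    now apply (alpha_convex_functional_expands n alpha beta f c r). }
  assert (Hp0 : p 0%R = 1%R).
  { assert (Hd0 : C_derive f 0%R = 1%R).
    { rewrite (local_series_0 _ _ _ (local_series_C_derive _ _ _ Hser)).
      unfold derived_coefficients. rewrite Hc1. simpl. ring. }
    unfold p, H, alpha_convex_functional, log_derivative.
    destruct (Ceq_dec 0%R 0%R) as [_|N]; [|contradiction].
    rewrite RtoC_minus. transitivity ((1 - beta) / (1 - beta))%C.
    - unfold Cdiv. ring.
    - field. exact HB0. }
  destruct (expands_slope 6 p) as [s1 [Hs1 E1]]; [intros; now apply Hp|].
  destruct (expands_slope 5 s1) as [s2 [Hs2 E2]]; [intros; now apply Hs1|].
  destruct (expands_slope 4 s2) as [s3 [Hs3 E3]]; [intros; now apply Hs2|].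
  destruct (expands_slope 3 s3) as [s4 [Hs4 E4]]; [intros; now apply Hs3|].
  rewrite Hp0 in E1.
  exists (s1 0%R / 2)%C, (s2 0%R / 2)%C, (s3 0%R / 2)%C. split.
  { apply (toeplitz_form_ge0 p s1 s2 s3).
    - intros z Hz. split; [now apply Hp|]. split; [|split].
      + apply (expands_le 3 6); [lia|now apply Hs1].
      + apply (expands_le 3 5); [lia|now apply Hs2].
      + apply (expands_le 3 4); [lia|now apply Hs3].
    - intros z Hz. auto.
    - reflexivity.
    - intros z Hz. specialize (Hconv z Hz). fold H in Hconv.
      unfold p. replace ((H z - beta) / (1 - beta))%C
        with (RtoC (/ (1 - beta)) * (H z + RtoC (- beta)))%C.
      2:{ rewrite RtoC_inv, RtoC_minus, RtoC_opp by lra. unfold Cdiv. ring. }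
      rewrite Re_RtoC_mult, re_plus. change (Re (RtoC (- beta))) with (- beta).
      apply Rmult_le_pos; [left; apply Rinv_0_lt_compat|]; lra. }
  set (P1 := s1 0%R) in *. set (P2 := s2 0%R) in *. set (P3 := s3 0%R) in *.
  assert (Jp : jet p 1%R P1 P2 P3).
  { exists s4. split; [apply (expands_le 0 3); [lia|now apply Hs4]|].
    generalize (near_in_disk _ Hdisk0). apply near_imp. intros z Hz _.
    rewrite E1, E2, E3, E4 by exact Hz. ring. }
  destruct (local_series_shift _ _ _ Hser) as [phi [Hphi Ef]].
  assert (L1 := local_series_C_derive _ _ _ Hser).
  assert (L2 := local_series_C_derive _ _ _ L1).
  assert (Jphi := local_series_jet _ _ _ Hphi).
  assert (J1 := local_series_jet _ _ _ L1).
  assert (J2 := local_series_jet _ _ _ L2).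
  assert (Hd0 : C_derive f 0%R <> 0%R).
  { rewrite (local_series_0 _ _ _ L1). unfold derived_coefficients. rewrite Hc1.
    simpl. rewrite Cmult_1_r. intro A. apply RtoC_inj in A. lra. }
  assert (Hphi0 : phi 0%R <> 0%R).
  { rewrite (local_series_0 _ _ _ Hphi), Hc1. intro A. apply RtoC_inj in A. lra. }
  assert (JL := jet_mult _ _ _ _ _ _ _ _ _ _
    (jet_plus _ _ _ _ _ _ _ _ _ _ (jet_const beta)
       (jet_mult _ _ _ _ _ _ _ _ _ _ (jet_const (1 - beta)%C) Jp))
    (jet_mult _ _ _ _ _ _ _ _ _ _ J1 Jphi)).
  assert (JRR := jet_plus _ _ _ _ _ _ _ _ _ _
    (jet_mult _ _ _ _ _ _ _ _ _ _ (jet_const (1 - alpha)%C)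
       (jet_mult _ _ _ _ _ _ _ _ _ _ J1 J1))
    (jet_mult _ _ _ _ _ _ _ _ _ _ (jet_const alpha)
       (jet_mult _ _ _ _ _ _ _ _ _ _
          (jet_plus _ _ _ _ _ _ _ _ _ _ J1
             (jet_mult _ _ _ _ _ _ _ _ _ _ jet_id J2)) Jphi))).
  eapply jet_ext in JL.
  - destruct (jet_unique _ _ _ _ _ _ _ _ _ JL JRR) as [_ [X1 [X2 X3]]].
    clear - X1 X2 X3 Hc1. unfold derived_coefficients in *.
    rewrite Hc1 in *. simpl INR in *.
    rewrite ?RtoC_plus in *.
    assert (Y1 : ((1 - beta) * P1 = (1 + alpha) * c 2%nat)%C).
    { match type of X1 with ?u = ?v =>
        transitivity (u - v + (1 + alpha) * c 2%nat)%C; [ring|rewrite X1; ring] end. }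
    assert (Y2 : ((1 - beta) * P2 = (2 + 4 * alpha) * c 3%nat
                    - (1 + 3 * alpha) * c 2%nat ^ 2)%C).
    { match type of X2 with ?u = ?v =>
        transitivity (u - v - 3 * c 2%nat * ((1 - beta) * P1 - (1 + alpha) * c 2%nat)
          + ((2 + 4 * alpha) * c 3%nat - (1 + 3 * alpha) * c 2%nat ^ 2))%C;
        [ring|rewrite X2, Y1; ring] end. }
    assert (Y3 : ((1 - beta) * P3 = (3 + 9 * alpha) * c 4%nat
       - (3 + 15 * alpha) * c 2%nat * c 3%nat + (1 + 7 * alpha) * c 2%nat ^ 3)%C).
    { match type of X3 with ?u = ?v =>
        transitivity (u - v
          - 3 * c 2%nat * ((1 - beta) * P2 - ((2 + 4 * alpha) * c 3%nat
                    - (1 + 3 * alpha) * c 2%nat ^ 2))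
          - (4 * c 3%nat + 2 * c 2%nat ^ 2) * ((1 - beta) * P1 - (1 + alpha) * c 2%nat)
          + ((3 + 9 * alpha) * c 4%nat
       - (3 + 15 * alpha) * c 2%nat * c 3%nat + (1 + 7 * alpha) * c 2%nat ^ 3))%C;
        [ring|rewrite X3, Y2, Y1; ring] end. }
    assert (H2 : RtoC 2 <> 0%R) by (intro A; apply RtoC_inj in A; lra).
    repeat split; [rewrite <- Y1|rewrite <- Y2|rewrite <- Y3]; field; exact H2.
  - generalize (near_and _ _ _ (near_0_ball r (proj1 Hser)) (near_and _ _ _
      (expands_near_neq0 _ _ (local_series_expands 1 _ _ _ L1) Hd0)
      (expands_near_neq0 _ _ (local_series_expands 1 _ _ _ Hphi) Hphi0))).
    apply near_imp. intros z [B1 [B2 B3]] N. cbv beta.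
    replace (beta + (1 - beta) * p z)%C with (H z) by (unfold p; field; exact HB0).
    unfold H, alpha_convex_functional, log_derivative.
    destruct (Ceq_dec z 0%R) as [E|_]; [contradiction|].
    rewrite (Ef z B1), Hc0, RtoC_minus. field. repeat split; try assumption.
Qed.

(** * Maximization of the Hankel determinant *)

(** Subtracting the relations for the inverse from those for the function
    isolates a_3 - a_2^2 and then a_4; what remains are quantities controlled by
    the Caratheodory region. *)
Lemma hankel_determinant_formula (alpha B : R) (a2 a3 a4 p1 p2 p3 q1 q2 q3 : C) :
  0 <= alpha -> 0 < B ->
  ((1 + alpha) * a2 = 2 * B * p1)%C ->
  ((2 + 4 * alpha) * a3 - (1 + 3 * alpha) * a2 ^ 2 = 2 * B * p2)%C ->
  ((3 + 9 * alpha) * a4 - (3 + 15 * alpha) * a2 * a3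
      + (1 + 7 * alpha) * a2 ^ 3 = 2 * B * p3)%C ->
  ((1 + alpha) * - a2 = 2 * B * q1)%C ->
  ((2 + 4 * alpha) * (2 * a2 ^ 2 - a3) - (1 + 3 * alpha) * (- a2) ^ 2 = 2 * B * q2)%C ->
  ((3 + 9 * alpha) * - (5 * a2 ^ 3 - 5 * a2 * a3 + a4)
      - (3 + 15 * alpha) * - a2 * (2 * a2 ^ 2 - a3)
      + (1 + 7 * alpha) * (- a2) ^ 3 = 2 * B * q3)%C ->
  a2 = (RtoC (2 * B / (1 + alpha)) * p1)%C /\ q1 = (- p1)%C /\
  (a2 * a4 - a3 ^ 2)%C =
   (RtoC (B / (4 * (1 + 2 * alpha))) * a2 ^ 2 * ((p2 - p1 ^ 2) - (q2 - q1 ^ 2))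
    + RtoC (B / (3 * (1 + 3 * alpha))) * a2 * (p3 - q3)
    - RtoC ((1 + alpha) / (3 * (1 + 3 * alpha))) * a2 ^ 4
    - RtoC (B ^ 2 / (4 * (1 + 2 * alpha) ^ 2)) * ((p2 - p1 ^ 2) - (q2 - q1 ^ 2)) ^ 2)%C.
Proof.
  intros Ha HB E1 E2 E3 G1 G2 G3.
  assert (NZ : forall x : R, 0 < x -> RtoC x <> 0%R).
  { intros x Hx A. apply RtoC_inj in A. lra. }
  assert (N2 := NZ 2 ltac:(lra)). assert (NB := NZ B HB).
  assert (Ne := NZ (1 + alpha) ltac:(lra)). assert (Nb := NZ (1 + 2 * alpha) ltac:(lra)).
  assert (Nd := NZ (1 + 3 * alpha) ltac:(lra)).
  assert (N3 := NZ 3 ltac:(lra)). assert (N4 := NZ 4 ltac:(lra)).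
  assert (N6 := NZ 6 ltac:(lra)).
  rewrite !RtoC_plus in *. rewrite !RtoC_mult in *.
  assert (A2 : a2 = (2 * B / (1 + alpha) * p1)%C).
  { transitivity ((1 + alpha) * a2 / (1 + alpha))%C; [field; exact Ne|].
    rewrite E1. field. exact Ne. }
  assert (Q1 : q1 = (- p1)%C).
  { transitivity ((2 * B * q1) / (2 * B))%C; [field; repeat split; assumption|].
    rewrite <- G1. transitivity (- ((1 + alpha) * a2) / (2 * B))%C; [field; repeat split; assumption|].
    rewrite E1. field; repeat split; assumption. }
  split; [|split; [exact Q1|]].
  { rewrite RtoC_div, RtoC_mult, RtoC_plus by lra. exact A2. }
  assert (A3 : a3 = (a2 ^ 2 + B * (p2 - q2) / (2 * (1 + 2 * alpha)))%C).
  { transitivity (a2 ^ 2 + (2 * B * p2 - 2 * B * q2) / (4 * (1 + 2 * alpha)))%C.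
    - rewrite <- E2, <- G2. field; repeat split; assumption.
    - field. repeat split; assumption. }
  assert (A4 : a4 = ((2 * B * (p3 - q3) + 15 * (1 + 3 * alpha) * a2 * a3
                      - (11 + 29 * alpha) * a2 ^ 3) / (6 * (1 + 3 * alpha)))%C).
  { transitivity ((2 * B * p3 - 2 * B * q3 + 15 * (1 + 3 * alpha) * a2 * a3
                      - (11 + 29 * alpha) * a2 ^ 3) / (6 * (1 + 3 * alpha)))%C.
    - rewrite <- E3, <- G3. field; repeat split; assumption.
    - field; repeat split; assumption. }
  rewrite !RtoC_div by nra. rewrite !RtoC_pow, !RtoC_mult, !RtoC_plus, !RtoC_pow, !RtoC_mult.
  replace (p2 - p1 ^ 2 - (q2 - q1 ^ 2))%C with (p2 - q2)%C by (rewrite Q1; ring).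
  rewrite A4, A3. rewrite !RtoC_plus, !RtoC_mult.
  field. repeat split; assumption.
Qed.

(** Replacing both Schur moduli l and l' by their mean and then by 1 only
    increases the bound: the difference has a factor 2 - (l + l') whose cofactor
    is affine in l + l' and nonnegative at both ends, because
    8 (1 + 2 alpha)^2 <= 9 (1 + alpha)(1 + 3 alpha). *)
Lemma schur_moduli_extremal (alpha B k l l' : R) :
  0 <= alpha <= 1 -> 0 < B -> 0 <= k <= 1 -> 0 <= l <= 1 -> 0 <= l' <= 1 ->
  let m := 1 - k ^ 2 in
  let x := 2 * B / (1 + alpha) * k in
  let S := fun l => k ^ 3 + m * (2 * k * l + k * l ^ 2 + (1 - l ^ 2)) in
  B / (4 * (1 + 2 * alpha)) * x ^ 2 * (m * l + m * l')
    + B / (3 * (1 + 3 * alpha)) * x * (S l + S l')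
    + (1 + alpha) / (3 * (1 + 3 * alpha)) * x ^ 4
    + B ^ 2 / (4 * (1 + 2 * alpha) ^ 2) * (m * l + m * l') ^ 2
  <= B ^ 2 * (
      16 * B ^ 2 / (3 * (1 + 3 * alpha) * (1 + alpha) ^ 3) * (k ^ 2) ^ 2
      + 2 * B / ((1 + alpha) ^ 2 * (1 + 2 * alpha)) * (k ^ 2 * m)
      + 4 / (3 * (1 + alpha) * (1 + 3 * alpha)) * ((k ^ 2) ^ 2 + 3 * (k ^ 2 * m))
      + / (1 + 2 * alpha) ^ 2 * m ^ 2).
Proof.
  intros Ha HB Hk Hl Hl' m x S.
  assert (Hm : 0 <= m) by (unfold m; nra).
  set (e := 1 + alpha). set (b := 1 + 2 * alpha). set (d := 1 + 3 * alpha).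
  assert (He : 1 <= e) by (unfold e; lra). assert (Hb : 1 <= b) by (unfold b; lra).
  assert (Hd : 1 <= d) by (unfold d; lra).
  set (s := l + l').
  assert (Hs : 0 <= s <= 2) by (unfold s; lra).
  (* K is the right-hand side minus the left-hand side. *)
  set (K := (2 - s) * (B / (4 * b) * x ^ 2 * m
      + B ^ 2 * m * (2 * k / (3 * d * e) * (2 * k - (1 - k) * (2 + s) / 2)
                     + m * (2 + s) / (4 * b ^ 2)))
      + B / (3 * d) * x * m * (1 - k) * ((l - l') ^ 2 / 2)).
  assert (Hx : 0 <= x).
  { unfold x. apply Rmult_le_pos; [|lra]. apply Rmult_le_pos; [lra|].
    left. apply Rinv_0_lt_compat. unfold e in He. lra. }
  assert (Hpos : forall u v, 0 <= u -> 0 < v -> 0 <= u / v).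
  { intros u v Hu Hv. apply Rmult_le_pos; [exact Hu|]. left. now apply Rinv_0_lt_compat. }
  assert (Hde : 0 < d * e) by nra. assert (Hb2 : 0 < b ^ 2) by nra.
  assert (Hcof : 0 <= 2 * k / (3 * d * e) * (2 * k - (1 - k) * (2 + s) / 2)
                     + m * (2 + s) / (4 * b ^ 2)).
  { assert (H89 : 8 * b ^ 2 <= 9 * (d * e)) by (unfold b, d, e; nra).
    assert (Hi : 8 / (9 * (d * e)) <= / b ^ 2).
    { apply (Rmult_le_reg_r (b ^ 2 * (9 * (d * e)))); [nra|].
      field_simplify; [|lra|lra]. lra. }
    assert (H1 : m * (2 + s) / 4 * (8 / (9 * (d * e))) <= m * (2 + s) / (4 * b ^ 2)).
    { replace (m * (2 + s) / (4 * b ^ 2)) with (m * (2 + s) / 4 * / b ^ 2) by (field; lra).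
      apply Rmult_le_compat_l; [|exact Hi]. nra. }
    assert (H2 : 0 <= (6 * k * (2 * k - (1 - k) * (2 + s) / 2) + 2 * m * (2 + s))
                      / (9 * (d * e))).
    { apply Hpos; [|lra]. unfold m.
      assert (Z0 : 0 <= 6 * k * (2 * k - (1 - k)) + 4 * (1 - k ^ 2)) by nra.
      assert (Z2 : 0 <= 6 * k * (2 * k - 2 * (1 - k)) + 8 * (1 - k ^ 2)) by nra.
      nra. }
    eapply Rle_trans; [exact H2|].
    replace ((6 * k * (2 * k - (1 - k) * (2 + s) / 2) + 2 * m * (2 + s)) / (9 * (d * e)))
      with (2 * k / (3 * d * e) * (2 * k - (1 - k) * (2 + s) / 2)
            + m * (2 + s) / 4 * (8 / (9 * (d * e)))) by (field; lra).
    lra. }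
  assert (HK : 0 <= K).
  { unfold K.
    assert (T1 : 0 <= B / (4 * b) * x ^ 2 * m).
    { apply Rmult_le_pos; [|exact Hm]. apply Rmult_le_pos; [|apply pow2_ge_0].
      apply Hpos; lra. }
    assert (T2 : 0 <= B ^ 2 * m) by (apply Rmult_le_pos; [apply pow2_ge_0|exact Hm]).
    assert (T3 : 0 <= B / (3 * d) * x * m * (1 - k)).
    { apply Rmult_le_pos; [|lra]. apply Rmult_le_pos; [|exact Hm].
      apply Rmult_le_pos; [|exact Hx]. apply Hpos; lra. }
    apply Rplus_le_le_0_compat.
    - apply Rmult_le_pos; [lra|]. apply Rplus_le_le_0_compat; [exact T1|].
      now apply Rmult_le_pos.
    - apply Rmult_le_pos; [exact T3|]. pose proof (pow2_ge_0 (l - l')). lra. }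
  match goal with |- ?L <= ?R => assert (E : R = L + K) end; [|lra].
  unfold K, S, s, x. fold e. unfold m. field. lra.
Qed.

Lemma quadratic_le_at_1 (A L c t : R) : 0 <= A -> 0 <= L -> 0 <= t <= 1 ->
  A * t ^ 2 + L * t + c <= A + L + c.
Proof.
  intros HA HL Ht. assert (H2 : 0 <= t ^ 2 <= 1) by nra.
  assert (A * t ^ 2 <= A * 1) by (apply Rmult_le_compat_l; lra).
  assert (L * t <= L * 1) by (apply Rmult_le_compat_l; lra). lra.
Qed.

Lemma quadratic_le_vertex (A L c t : R) : A < 0 ->
  A * t ^ 2 + L * t + c <= c - L ^ 2 / (4 * A).
Proof.
  intros HA.
  assert (E : c - L ^ 2 / (4 * A) - (A * t ^ 2 + L * t + c) = - A * (t + L / (2 * A)) ^ 2)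
    by (field; lra).
  pose proof (pow2_ge_0 (t + L / (2 * A))). nra.
Qed.

Lemma Cmod_hankel_expression_le (x y u v : C) (c1 c2 c3 c4 X U V : R) :
  0 <= c1 -> 0 <= c2 -> 0 <= c3 -> 0 <= c4 ->
  Cmod x = X -> Cmod u <= U -> Cmod v <= V ->
  Cmod (RtoC c1 * x ^ 2 * u + RtoC c2 * x * v - RtoC c3 * x ^ 4 - RtoC c4 * u ^ 2)%C
  <= c1 * X ^ 2 * U + c2 * X * V + c3 * X ^ 4 + c4 * U ^ 2.
Proof.
  intros H1 H2 H3 H4 Hx Hu Hv.
  assert (M : forall c z, 0 <= c -> Cmod (RtoC c * z)%C = c * Cmod z).
  { intros c z Hc. rewrite Cmod_mult, Cmod_R, Rabs_pos_eq; trivial. }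
  pose proof (Cmod_ge_0 x). pose proof (Cmod_ge_0 u). pose proof (Cmod_ge_0 v).
  unfold Cminus.
  eapply Rle_trans; [apply Cmod_triangle|]. apply Rplus_le_compat.
  2:{ rewrite Cmod_opp, M, Cmod_pow by assumption.
      apply Rmult_le_compat_l; [assumption|]. now apply pow_incr. }
  eapply Rle_trans; [apply Cmod_triangle|]. apply Rplus_le_compat.
  2:{ rewrite Cmod_opp, M, Cmod_pow, Hx by assumption. lra. }
  eapply Rle_trans; [apply Cmod_triangle|].
  rewrite <- !Cmult_assoc, !M, !Cmod_mult, Cmod_pow, Hx by assumption.
  rewrite !Rmult_assoc.
  apply Rplus_le_compat; (apply Rmult_le_compat_l; [assumption|]);
    apply Rmult_le_compat_l; trivial.
  - apply pow2_ge_0.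
  - lra.
Qed.

(** Both cases maximize one quadratic in t = |c_1|^2 over [0, 1], with leading
    coefficient D / (3 (1+alpha)^3 (1+3 alpha) (1+2 alpha)^2). *)
Lemma hankel_determinant_majorant (alpha beta : R) (f g : C -> C) (a : nat -> C) :
  0 <= alpha <= 1 -> 0 <= beta < 1 ->
  normalized_expansion f a -> univalent_in_disk f ->
  alpha_convex_of_order alpha beta f ->
  univalent_inverse f g -> alpha_convex_of_order alpha beta g ->
  let B := 1 - beta in
  exists t, 0 <= t <= 1 /\
  Cmod (a 2%nat * a 4%nat - a 3%nat ^ 2)%C <=
  B ^ 2 * (
      (16 * B ^ 2 / (3 * (1 + 3 * alpha) * (1 + alpha) ^ 3)
       - 2 * B / ((1 + alpha) ^ 2 * (1 + 2 * alpha))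
       - 8 / (3 * (1 + alpha) * (1 + 3 * alpha)) + / (1 + 2 * alpha) ^ 2) * t ^ 2
      + (2 * B / ((1 + alpha) ^ 2 * (1 + 2 * alpha))
         + 4 / ((1 + alpha) * (1 + 3 * alpha)) - 2 / (1 + 2 * alpha) ^ 2) * t
      + / (1 + 2 * alpha) ^ 2).
Proof.
  intros Ha Hb [Ha0 [Ha1 Hser]] Hf Hcf [Hg [r [Hr Hfg]]] Hcg B.
  assert (HB : 0 < B) by (unfold B; lra).
  assert (Lf : local_series a 1 f) by (split; [lra|exact Hser]).
  assert (H00 : Cmod (RtoC 0) < r) by (rewrite Cmod_0; lra).
  assert (Hd0 : in_disk (RtoC 0)) by (unfold in_disk; rewrite Cmod_0; lra).
  assert (Hf0 : f (RtoC 0) = RtoC 0) by (rewrite (local_series_0 _ _ _ Lf); exact Ha0).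
  assert (Hg0 : g (RtoC 0) = RtoC 0).
  { destruct (Hfg _ H00) as [A1 A2]. apply (proj2 Hf); [exact A1|exact Hd0|].
    now rewrite A2. }
  destruct (proj1 Hg (RtoC 0) Hd0) as [b [s [Hs Hgs]]].
  assert (Lg : local_series b s g).
  { split; [exact Hs|]. intros h Hh. replace h with (h - 0%R)%C at 1 by ring.
    apply Hgs. now replace (h - 0%R)%C with h by ring. }
  assert (Hb0 : b 0%nat = RtoC 0) by (rewrite <- (local_series_0 _ _ _ Lg); exact Hg0).
  destruct (inverse_coefficients f g a b 1 s Lf Lg Ha0 Ha1 Hb0) as [Hb1 [Hb2 [Hb3 Hb4]]].
  { generalize (near_0_ball r Hr). apply near_imp. intros w Hw. now apply Hfg. }
  destruct (alpha_convex_coefficient_region alpha beta f a 1 ltac:(lra) ltac:(lra)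
              Hf Lf Ha0 Ha1 Hcf) as [p1 [p2 [p3 [Tp [E1 [E2 E3]]]]]].
  destruct (alpha_convex_coefficient_region alpha beta g b s ltac:(lra) ltac:(lra)
              Hg Lg Hb0 Hb1 Hcg) as [q1 [q2 [q3 [Tq [G1 [G2 G3]]]]]].
  rewrite Hb2, Hb3 in *. rewrite Hb4 in *. rewrite <- !RtoC_minus in *. fold B in E1, E2, E3, G1, G2, G3.
  destruct (hankel_determinant_formula alpha B (a 2%nat) (a 3%nat) (a 4%nat)
              p1 p2 p3 q1 q2 q3 ltac:(lra) HB E1 E2 E3 G1 G2 G3) as [A2 [Q1 HH]].
  destruct (caratheodory_region p1 p2 p3 Tp) as [Hk [l [Hl [Hl2 Hl3]]]].
  destruct (caratheodory_region q1 q2 q3 Tq) as [_ [l' [Hl' [Hl2' Hl3']]]].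
  assert (Hq : Cmod q1 = Cmod p1) by (rewrite Q1; apply Cmod_opp).
  rewrite Hq in Hl2', Hl3'.
  set (k := Cmod p1) in *.
  assert (Hk0 : 0 <= k) by apply Cmod_ge_0.
  assert (Hm : 0 <= 1 - k ^ 2) by nra.
  exists (k ^ 2). split; [nra|]. rewrite HH.
  assert (Hpos : forall u v, 0 <= u -> 0 < v -> 0 <= u / v).
  { intros u v Hu Hv. apply Rmult_le_pos; [exact Hu|]. left. now apply Rinv_0_lt_compat. }
  assert (Hb2' : 0 < (1 + 2 * alpha) ^ 2) by (apply pow_lt; lra).
  set (S := fun l => k ^ 3 + (1 - k ^ 2) * (2 * k * l + k * l ^ 2 + (1 - l ^ 2))) in *.
  eapply Rle_trans.
  { apply (Cmod_hankel_expression_le (a 2%nat) 0 _ _ _ _ _ _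
             (2 * B / (1 + alpha) * k) ((1 - k ^ 2) * l + (1 - k ^ 2) * l') (S l + S l')).
    - apply Hpos; lra.
    - apply Hpos; lra.
    - apply Hpos; lra.
    - apply Hpos; [apply pow2_ge_0|lra].
    - rewrite A2, Cmod_mult, Cmod_R, Rabs_pos_eq; [reflexivity|]. apply Hpos; lra.
    - unfold Cminus at 1. eapply Rle_trans; [apply Cmod_triangle|]. rewrite Cmod_opp. lra.
    - unfold Cminus at 1. eapply Rle_trans; [apply Cmod_triangle|]. rewrite Cmod_opp.
      unfold S. lra. }
  eapply Rle_trans.
  { apply (schur_moduli_extremal alpha B k l l'); trivial. split; [exact Hk0|exact Hk]. }
  apply Req_le. field. lra.
Qed.

(** * The two ranges of beta *)

Lemma sqr_le_of_sqrt_le (x y : R) : 0 <= x -> sqrt x <= y -> x <= y ^ 2.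
Proof.
  intros Hx H. pose proof (sqrt_pos x). rewrite <- (sqrt_sqrt x Hx). nra.
Qed.

Lemma sqr_lt_of_lt_sqrt (x y : R) : 0 <= x -> - sqrt x < y < sqrt x -> y ^ 2 < x.
Proof. intros Hx H. rewrite <- (sqrt_sqrt x Hx). nra. Qed.

(** The first hypothesis on beta says that 1 - beta is at least the larger root
    of D, viewed as a polynomial in 1 - beta. *)
Lemma leading_coefficient_ge0 (alpha beta : R) : 0 <= alpha ->
  beta <= 1 - (1 + alpha) *
       (3 * (1 + 3 * alpha) +
        sqrt (9 * (1 + 3 * alpha) ^ 2 - 48 * (1 + alpha) * (1 + 3 * alpha)
              + 128 * (1 + 2 * alpha) ^ 2)) / (16 * (1 + 2 * alpha)) ->
  0 <= (16 * (1 - beta) ^ 2 * (1 + 2 * alpha)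
      - 6 * (1 - beta) * (1 + alpha) * (1 + 3 * alpha)) * (1 + 2 * alpha)
     + (1 + alpha) ^ 2 *
       (3 * (1 + alpha) * (1 + 3 * alpha) - 8 * (1 + 2 * alpha) ^ 2).
Proof.
  intros Ha H.
  set (r := 9 * (1 + 3 * alpha) ^ 2 - 48 * (1 + alpha) * (1 + 3 * alpha)
              + 128 * (1 + 2 * alpha) ^ 2) in *.
  assert (Hr : 0 <= r) by (unfold r; nra).
  set (y := 16 * (1 + 2 * alpha) * (1 - beta) / (1 + alpha) - 3 * (1 + 3 * alpha)).
  assert (Hy : sqrt r <= y).
  { unfold y. apply (Rmult_le_reg_l ((1 + alpha) / (16 * (1 + 2 * alpha)))).
    - apply Rdiv_lt_0_compat; lra.
    - replace ((1 + alpha) / (16 * (1 + 2 * alpha)) * (_ - _)) with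
        (1 - beta - (1 + alpha) * (3 * (1 + 3 * alpha)) / (16 * (1 + 2 * alpha)))
        by (field; lra).
      replace ((1 + alpha) / (16 * (1 + 2 * alpha)) * sqrt r) with
        ((1 + alpha) * (3 * (1 + 3 * alpha) + sqrt r) / (16 * (1 + 2 * alpha))
         - (1 + alpha) * (3 * (1 + 3 * alpha)) / (16 * (1 + 2 * alpha)))
        by (field; lra).
      lra. }
  apply (sqr_le_of_sqrt_le r y Hr) in Hy.
  match goal with |- 0 <= ?D => assert (E : y ^ 2 - r = 16 / (1 + alpha) ^ 2 * D) end.
  { unfold y, r. field. lra. }
  apply (Rmult_le_reg_l (16 / (1 + alpha) ^ 2)).
  - apply Rdiv_lt_0_compat; [lra|]. apply pow_lt. lra.
  - rewrite <- E. lra.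
Qed.

(** The derivative at t = 1 of the quadratic in t is itself quadratic in
    1 - beta, and the second hypothesis on beta puts 1 - beta below its larger
    root, where it is negative.  Since the quadratic in t increases at t = 0, its
    leading coefficient is negative. *)
Lemma leading_coefficient_lt0 (alpha beta : R) : 0 <= alpha ->
  1 - (1 + alpha) *
       (3 * (1 + 3 * alpha) +
        sqrt (9 * (1 + 3 * alpha) ^ 2 + 128 * (1 + 2 * alpha) ^ 2))
       / (32 * (1 + 2 * alpha)) < beta < 1 ->
  (16 * (1 - beta) ^ 2 * (1 + 2 * alpha)
      - 6 * (1 - beta) * (1 + alpha) * (1 + 3 * alpha)) * (1 + 2 * alpha)
     + (1 + alpha) ^ 2 *
       (3 * (1 + alpha) * (1 + 3 * alpha) - 8 * (1 + 2 * alpha) ^ 2) < 0.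
Proof.
  intros Ha [H H1].
  set (r := 9 * (1 + 3 * alpha) ^ 2 + 128 * (1 + 2 * alpha) ^ 2) in *.
  assert (Hr : 0 <= r) by (unfold r; nra).
  set (y := 32 * (1 + 2 * alpha) * (1 - beta) / (1 + alpha) - 3 * (1 + 3 * alpha)).
  assert (Hy1 : y < sqrt r).
  { unfold y. apply (Rmult_lt_reg_l ((1 + alpha) / (32 * (1 + 2 * alpha)))).
    - apply Rdiv_lt_0_compat; lra.
    - replace ((1 + alpha) / (32 * (1 + 2 * alpha)) * (_ - _)) with
        (1 - beta - (1 + alpha) * (3 * (1 + 3 * alpha)) / (32 * (1 + 2 * alpha)))
        by (field; lra).
      replace ((1 + alpha) / (32 * (1 + 2 * alpha)) * sqrt r) with
        ((1 + alpha) * (3 * (1 + 3 * alpha) + sqrt r) / (32 * (1 + 2 * alpha))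
         - (1 + alpha) * (3 * (1 + 3 * alpha)) / (32 * (1 + 2 * alpha)))
        by (field; lra).
      lra. }
  assert (Hy0 : - (3 * (1 + 3 * alpha)) < y).
  { unfold y. assert (0 < 32 * (1 + 2 * alpha) * (1 - beta) / (1 + alpha)); [|lra].
    apply Rdiv_lt_0_compat; nra. }
  assert (Hs : 3 * (1 + 3 * alpha) <= sqrt r).
  { rewrite <- (sqrt_pow2 (3 * (1 + 3 * alpha))) by lra.
    apply sqrt_le_1_alt. unfold r. nra. }
  assert (Hy : y ^ 2 < r) by (apply sqr_lt_of_lt_sqrt; lra).
  set (B := 1 - beta) in *. assert (HB : 0 < B) by (unfold B; lra).
  assert (E : y ^ 2 - r = 64 * (1 + 2 * alpha) / (1 + alpha) ^ 2 *
     (16 * B ^ 2 * (1 + 2 * alpha) - 3 * B * (1 + alpha) * (1 + 3 * alpha)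
      - 2 * (1 + alpha) ^ 2 * (1 + 2 * alpha))).
  { unfold y, r. field. lra. }
  assert (F : 16 * B ^ 2 * (1 + 2 * alpha) - 3 * B * (1 + alpha) * (1 + 3 * alpha)
      - 2 * (1 + alpha) ^ 2 * (1 + 2 * alpha) < 0).
  { apply (Rmult_lt_reg_l (64 * (1 + 2 * alpha) / (1 + alpha) ^ 2)).
    - apply Rdiv_lt_0_compat; [lra|]. apply pow_lt. lra.
    - rewrite <- E. lra. }
  set (T := 16 * B ^ 2 * (1 + 2 * alpha) - 3 * B * (1 + alpha) * (1 + 3 * alpha)
      - 2 * (1 + alpha) ^ 2 * (1 + 2 * alpha)) in *.
  assert (F1 : (1 + 2 * alpha) * T < 0) by nra.
  assert (F2 : 0 <= 3 * B * (1 + alpha) * (1 + 3 * alpha) * (1 + 2 * alpha)).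
  { repeat apply Rmult_le_pos; lra. }
  assert (F3 : 0 <= 3 * (1 + alpha) ^ 2 * (2 * (1 + 2 * alpha) ^ 2 - (1 + alpha) * (1 + 3 * alpha))).
  { apply Rmult_le_pos; [|nra]. pose proof (pow2_ge_0 (1 + alpha)). lra. }
  unfold T in F1. lra.
Qed.

Theorem theorem2p1 :
  forall (alpha beta : R) (f : C -> C) (a : nat -> C),
  0 <= alpha <= 1 -> 0 <= beta < 1 ->
  normalized_expansion f a ->
  class_M alpha beta f ->
  (0 <= beta <= 1 - (1 + alpha) *
       (3 * (1 + 3 * alpha) +
        sqrt (9 * (1 + 3 * alpha) ^ 2 - 48 * (1 + alpha) * (1 + 3 * alpha)
              + 128 * (1 + 2 * alpha) ^ 2)) / (16 * (1 + 2 * alpha)) ->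
   Cmod (a 2%nat * a 4%nat - a 3%nat ^ 2)%C <=
     4 * (1 - beta) ^ 2 / (3 * (1 + alpha) ^ 3 * (1 + 3 * alpha)) *
     (4 * (1 - beta) ^ 2 + (1 + alpha) ^ 2))
  /\
  (1 - (1 + alpha) *
       (3 * (1 + 3 * alpha) +
        sqrt (9 * (1 + 3 * alpha) ^ 2 + 128 * (1 + 2 * alpha) ^ 2))
       / (32 * (1 + 2 * alpha)) < beta < 1 ->
   let N :=
     (1 - beta) ^ 2 * (1 + 3 * alpha) * (13 + 7 * alpha)
     - 12 * (1 - beta) * (1 + alpha) * (1 + 2 * alpha) * (1 + 3 * alpha)
     - 4 * (1 + alpha) ^ 2 * (9 * alpha ^ 2 + 8 * alpha + 2) in
   let D :=
     (16 * (1 - beta) ^ 2 * (1 + 2 * alpha)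
      - 6 * (1 - beta) * (1 + alpha) * (1 + 3 * alpha)) * (1 + 2 * alpha)
     + (1 + alpha) ^ 2 *
       (3 * (1 + alpha) * (1 + 3 * alpha) - 8 * (1 + 2 * alpha) ^ 2) in
   Cmod (a 2%nat * a 4%nat - a 3%nat ^ 2)%C <=
     (1 - beta) ^ 2 / ((1 + alpha) * (1 + 3 * alpha)) * (N / D)).
Proof.
  intros alpha beta f a Ha Hb Hser [[_ [Hf _]] [Hcf [g [Hg Hcg]]]].
  destruct (hankel_determinant_majorant alpha beta f g a Ha Hb Hser Hf Hcf Hg Hcg)
    as [t [Ht Hmaj]].
  set (B := 1 - beta) in *. assert (HB : 0 < B) by (unfold B; lra).
  set (E := Cmod _) in *.
  assert (Hb2 : 0 < (1 + 2 * alpha) ^ 2) by (apply pow_lt; lra).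
  set (A := 16 * B ^ 2 / (3 * (1 + 3 * alpha) * (1 + alpha) ^ 3) - _ - _ + _) in Hmaj.
  set (L := 2 * B / ((1 + alpha) ^ 2 * (1 + 2 * alpha)) + _ - _) in Hmaj.
  assert (HL : 0 <= L).
  { unfold L.
    assert (0 <= 2 * B / ((1 + alpha) ^ 2 * (1 + 2 * alpha))).
    { left. apply Rdiv_lt_0_compat; [lra|]. apply Rmult_lt_0_compat; [apply pow_lt|]; lra. }
    assert (0 <= 4 / ((1 + alpha) * (1 + 3 * alpha)) - 2 / (1 + 2 * alpha) ^ 2); [|lra].
    replace (4 / ((1 + alpha) * (1 + 3 * alpha)) - 2 / (1 + 2 * alpha) ^ 2) with
      ((4 * (1 + 2 * alpha) ^ 2 - 2 * ((1 + alpha) * (1 + 3 * alpha))) /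
       ((1 + alpha) * (1 + 3 * alpha) * (1 + 2 * alpha) ^ 2)) by (field; lra).
    apply Rmult_le_pos; [nra|]. left. apply Rinv_0_lt_compat.
    repeat apply Rmult_lt_0_compat; lra. }
  set (w := 3 * (1 + alpha) ^ 3 * (1 + 3 * alpha) * (1 + 2 * alpha) ^ 2).
  assert (Hw : 0 < w) by (unfold w; repeat apply Rmult_lt_0_compat; lra).
  assert (HA : w * A = (16 * B ^ 2 * (1 + 2 * alpha)
      - 6 * B * (1 + alpha) * (1 + 3 * alpha)) * (1 + 2 * alpha)
     + (1 + alpha) ^ 2 *
       (3 * (1 + alpha) * (1 + 3 * alpha) - 8 * (1 + 2 * alpha) ^ 2))
    by (unfold w, A; field; lra).
  assert (HB2 : 0 <= B ^ 2) by apply pow2_ge_0.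
  split.
  - intros [_ H]. apply leading_coefficient_ge0 in H; [|lra]. fold B in H.
    rewrite <- HA in H.
    assert (HA0 : 0 <= A) by (apply (Rmult_le_reg_l w); lra).
    eapply Rle_trans; [exact Hmaj|].
    eapply Rle_trans.
    { apply Rmult_le_compat_l; [exact HB2|]. now apply quadratic_le_at_1. }
    apply Req_le. unfold A, L. field. lra.
  - intros H N D. apply leading_coefficient_lt0 in H; [|lra]. fold B in H.
    change (D < 0) in H. change (w * A = D) in HA.
    assert (HA0 : A < 0).
    { apply (Rmult_lt_reg_l w); [exact Hw|]. rewrite Rmult_0_r, HA. exact H. }
    eapply Rle_trans; [exact Hmaj|].
    eapply Rle_trans.
    { apply Rmult_le_compat_l; [exact HB2|]. now apply quadratic_le_vertex. }
    apply Req_le.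
    assert (HAD : A = D / w) by (rewrite <- HA; field; lra).
    (* The numerator of the vertex value is divisible by (1 + 2 alpha)^2. *)
    assert (HN : (1 + 2 * alpha) ^ 2 * N = (1 + 3 * alpha) * (1 + alpha) * D
       - 3 * (B * (1 + 3 * alpha) * (1 + 2 * alpha) + 2 * (1 + alpha) * (1 + 2 * alpha) ^ 2
              - (1 + 3 * alpha) * (1 + alpha) ^ 2) ^ 2).
    { unfold N, D. fold B. ring. }
    replace N with (((1 + 3 * alpha) * (1 + alpha) * D
       - 3 * (B * (1 + 3 * alpha) * (1 + 2 * alpha) + 2 * (1 + alpha) * (1 + 2 * alpha) ^ 2
              - (1 + 3 * alpha) * (1 + alpha) ^ 2) ^ 2) / (1 + 2 * alpha) ^ 2)
      by (rewrite <- HN; field; lra).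
    rewrite HAD. clear HN HAD HA N HA0. clearbody D. unfold L, w. fold B. field.
    repeat split; lra.
Qed.
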